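(* Let $(X,d,\mu)$ be a space of homogeneous type with $\mu(X)=\infty$ and $\mu(\{x_0\})=0$ for every $x_0\in X$, and let $\mathbb{Q}$ be the doubling order of $\mu$. Let $T$ be a Calderón–Zygmund operator on $(X,d,\mu)$ whose kernel $K$ is an $\omega$-Calderón–Zygmund kernel with $\omega$ satisfying the Dini condition, and suppose $K$ is non-degenerate: there are positive constants $c_0,\bar C$ such that for every $x\in X$ and $r>0$ there exists $y\in B(x,\bar C r)\setminus B(x,r)$ with $|K(x,y)|\ge \frac{1}{c_0\,\mu(B(x,r))}$. Let $1<p\le q<\infty$, $\frac{\alpha}{\mathbb{Q}}=\frac1p-\frac1q$, $\lambda_1\in A_{p,p}$, $\lambda_2\in A_{q,q}$, and let $\nu=(\lambda_1/\lambda_2)^{\frac{1}{1/p+1/q'}}$ be the fractional Bloom weight. Then there exists a constant $C>0$, independent of $b$, such that for every $b\in L^1_{\rm loc}(X)$: if $[b,T]$ is bounded from $L^p_{\lambda_1}(X)$ to $L^q_{\lambda_2}(X)$, then $b\in\mathrm{BMO}^\alpha_\nu(X)$ and $$\|b\|_{\mathrm{BMO}^\alpha_\nu(X)}\le C\,\|[b,T]\|_{L^p_{\lambda_1}(X)\to L^q_{\lambda_2}(X)}.$$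
   Context: Space of homogeneous type: $(X,d,\mu)$ where $d:X\times X\to[0,\infty)$ is a quasi-metric ($d$ symmetric; $d(x,y)=0$ iff $x=y$; $d(x,y)\le A_0(d(x,z)+d(z,y))$ with a constant $A_0\ge1$). Balls are $B(x,r)=\{y:d(x,y)<r\}$. A set $U$ is open if each $x\in U$ has some $B(x,r)\subset U$, $r>0$; measurable sets are the Borel sets of this topology, and all balls are assumed to be Borel. $\mu$ is a nonnegative Borel measure with $0<\mu(B(x,2r))\le C_\mu\,\mu(B(x,r))<\infty$ for all $x\in X$, $r>0$; $C_\mu$ denotes the smallest such constant and $\mathbb{Q}:=\log_2 C_\mu$ is the doubling order. The support of $f$ is the closure of $\{f\ne0\}$. A set is bounded if contained in a ball. Functions are complex-valued. $L^1_{\rm loc}(X)$: measurable functions integrable over every ball. $L^\infty_{\rm bs}(X)$: bounded measurable functions with bounded support. $\|f\|_{L^p_w(X)}:=\left(\int_X|f w|^p\,d\mu\right)^{1/p}$. $w(E)=\int_E w\,d\mu$, $\langle b\rangle_B=\frac1{\mu(B)}\int_B b\,d\mu$, $p'=p/(p-1)$. Weights: for $1<p<\infty$, a locally integrable $w:X\to(0,\infty)$ is in $A_p$ if $[w]_{A_p}:=\sup_B \mu(B)^{-p}\left(\int_B w\,d\mu\right)\left(\int_B w^{-1/(p-1)}\,d\mu\right)^{p-1}<\infty$ (sup over all balls); $w\in A_{p,p}$ if $w^p\in A_p$, with $[w]_{A_{p,p}}:=[w^p]_{A_p}^{1/p}$. $b\in L^1_{\rm loc}(X)$ belongs to $\mathrm{BMO}^\alpha_\nu(X)$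 if $\|b\|_{\mathrm{BMO}^\alpha_\nu(X)}:=\sup_B \nu(B)^{-\alpha/\mathbb{Q}}\,\frac{1}{\nu(B)}\int_B|b-\langle b\rangle_B|\,d\mu<\infty$ (sup over all balls). $\omega$-Calderón–Zygmund kernel: a function $K:(X\times X)\setminus\{(x,x):x\in X\}\to\mathbb{C}$ such that, with $V(x,y)=\mu(B(x,d(x,y)))$, $|K(x,y)|\le c_K/V(x,y)$ for all $x\ne y$, and $|K(x,y)-K(x',y)|+|K(y,x)-K(y,x')|\le \frac{1}{V(x,y)}\,\omega\!\left(\frac{d(x,x')}{d(x,y)}\right)$ whenever $d(x,x')<(2A_0)^{-1}d(x,y)$, where $\omega:[0,1]\to[0,\infty)$ is continuous, increasing, subadditive and $\omega(0)=0$. Dini condition: $\int_0^1\omega(t)\frac{dt}{t}<\infty$. Calderón–Zygmund operator: a linear operator $T$ bounded on $L^2(X)$ with an $\omega$-Calderón–Zygmund kernel $K$ such that $Tf(x)=\int_X K(x,y)f(y)\,d\mu(y)$ for $f\in L^2(X)$ and $x\notin\mathrm{supp}(f)$. When $\omega$ satisfies the Dini condition, $T$ has a unique bounded extension $T:L^1(X)\to L^{1,\infty}(X)$, for which the same integral formula holds for $f\in L^1(X)$ and $x\notin\mathrm{supp}(f)$. For $b\in L^1_{\rm loc}(X)$ and $f\in L^\infty_{\rm bs}(X)$ the commutator is $[b,T]f:=bTf-T(bf)$. Boundedness and the operator norm of $[b,T]$ from $L^p_{\lambda_1}(X)$ to $L^q_{\lambda_2}(X)$ refer to the best constant $\Theta<\infty$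 with $\|[b,T]f\|_{L^q_{\lambda_2}(X)}\le\Theta\|f\|_{L^p_{\lambda_1}(X)}$ for all $f\in L^\infty_{\rm bs}(X)$ (a dense subspace). *)

(* Defs.v *)
From HB Require Import structures.
From mathcomp Require Import all_boot all_order all_algebra.
From mathcomp Require Import all_classical all_reals all_analysis.
From mathcomp Require Export complex.
Set Implicit Arguments.
Unset Strict Implicit.
Unset Printing Implicit Defensive.
Import Order.TTheory GRing.Theory Num.Theory.
Import numFieldNormedType.Exports.
Local Open Scope classical_set_scope.
Local Open Scope ring_scope.

Record quasi_metric (R : realType) (X : Type) (rho : X -> X -> R) (A0 : R)
    : Prop := QuasiMetric {
  qmetric_ge0 : forall x y, 0 <= rho x y ;
  qmetric_sym : forall x y, rho x y = rho y x ;
  qmetric_eq0 : forall x y, rho x y = 0 <-> x = y ;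
  qmetric_A0_ge1 : 1 <= A0 ;
  qmetric_triangle : forall x y z, rho x y <= A0 * (rho x z + rho z y) }.

Definition qball (R : realType) (X : Type) (rho : X -> X -> R) (x : X) (r : R)
  : set X := [set y | rho x y < r].

Definition qopen (R : realType) (X : Type) (rho : X -> X -> R) (U : set X)
  : Prop := forall x, U x -> exists2 r : R, 0 < r & qball rho x r `<=` U.

Definition qclosure (R : realType) (X : Type) (rho : X -> X -> R) (A : set X)
  : set X := [set x | forall U, qopen rho U -> U x -> U `&` A !=set0].

Definition qbounded (R : realType) (X : Type) (rho : X -> X -> R) (A : set X)
  : Prop := exists x (r : R), A `<=` qball rho x r.

Definition qsupport (R : realType) (X : Type) (rho : X -> X -> R)
  (f : X -> R[i]) : set X := qclosure rho [set x | f x != 0].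

Definition doubling_bound (R : realType) d (X : measurableType d)
    (rho : X -> X -> R) (mu : {measure set X -> \bar R}) (C : R) : Prop :=
  forall x (r : R), 0 < r ->
    (mu (qball rho x (2 * r)) <= C%:E * mu (qball rho x r))%E.

Record homogeneous_space (R : realType) d (X : measurableType d)
    (rho : X -> X -> R) (A0 : R) (mu : {measure set X -> \bar R})
    : Prop := HomogeneousSpace {
  hspace_qmetric : quasi_metric rho A0 ;
  hspace_borel : @measurable d X = <<s [set U | qopen rho U] >> ;
  hspace_ball_measurable :
    forall x (r : R), 0 < r -> measurable (qball rho x r) ;
  hspace_ball_gt0 : forall x (r : R), 0 < r -> (0 < mu (qball rho x r))%E ;
  hspace_ball_fin : forall x (r : R), 0 < r -> (mu (qball rho x r) < +oo)%E ;
  hspace_doubling : exists C : R, doubling_bound rho mu C }.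

Definition doubling_constant (R : realType) d (X : measurableType d)
    (rho : X -> X -> R) (mu : {measure set X -> \bar R}) : R :=
  inf [set C : R | doubling_bound rho mu C].

Definition doubling_order (R : realType) d (X : measurableType d)
    (rho : X -> X -> R) (mu : {measure set X -> \bar R}) : R :=
  ln (doubling_constant rho mu) / ln 2.

Definition cabs (R : realType) (z : R[i]) : R := ComplexField.Normc.normc z.

Definition cmeasurable (R : realType) d (X : measurableType d)
    (f : X -> R[i]) : Prop :=
  measurable_fun setT (fun x => complex.Re (f x)) /\
  measurable_fun setT (fun x => complex.Im (f x)).

Definition cintegral (R : realType) d (X : measurableType d)
    (mu : {measure set X -> \bar R}) (D : set X) (f : X -> R[i]) : R[i] :=
  Complex (\int[mu]_(x in D) complex.Re (f x))
          (\int[mu]_(x in D) complex.Im (f x)).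

Definition caverage (R : realType) d (X : measurableType d)
    (mu : {measure set X -> \bar R}) (B : set X) (f : X -> R[i]) : R[i] :=
  Complex (fine (mu B))^-1 0 * cintegral mu B f.

Definition Lp_norm (R : realType) d (X : measurableType d)
    (mu : {measure set X -> \bar R}) (p : R) (w : X -> R) (f : X -> R[i])
    : \bar R :=
  Lnorm mu p%:E (fun x => (cabs (f x) * w x)%:E).

Definition in_Lp (R : realType) d (X : measurableType d)
    (mu : {measure set X -> \bar R}) (p : R) (f : X -> R[i]) : Prop :=
  cmeasurable f /\ (Lp_norm mu p (fun=> 1%R) f < +oo)%E.

Definition L1loc (R : realType) d (X : measurableType d)
    (rho : X -> X -> R) (mu : {measure set X -> \bar R}) (f : X -> R[i])
    : Prop :=
  cmeasurable f /\
  forall x (r : R), 0 < r ->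
    (\int[mu]_(y in qball rho x r) (cabs (f y))%:E < +oo)%E.

Definition Linfty_bs (R : realType) d (X : measurableType d)
    (rho : X -> X -> R) (f : X -> R[i]) : Prop :=
  [/\ cmeasurable f,
      exists M : R, forall x, cabs (f x) <= M &
      qbounded rho (qsupport rho f)].

Definition Ap_constant (R : realType) d (X : measurableType d)
    (rho : X -> X -> R) (mu : {measure set X -> \bar R}) (p : R) (w : X -> R)
    : \bar R :=
  ereal_sup [set s | exists x (r : R), 0 < r /\
    let B := qball rho x r in
    s = ((fine (mu B) `^ (- p))%:E * (\int[mu]_(y in B) (w y)%:E) *
         (\int[mu]_(y in B) (w y `^ (- (p - 1)^-1))%:E) `^ (p - 1))%E].

Record Ap_weight (R : realType) d (X : measurableType d)
    (rho : X -> X -> R) (mu : {measure set X -> \bar R}) (p : R) (w : X -> R)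
    : Prop := ApWeight {
  Ap_gt0 : forall x, 0 < w x ;
  Ap_measurable : measurable_fun setT w ;
  Ap_locally_integrable : forall x (r : R), 0 < r ->
    (\int[mu]_(y in qball rho x r) (w y)%:E < +oo)%E ;
  Ap_constant_fin : (Ap_constant rho mu p w < +oo)%E }.

(* Positivity of [w] is a separate requirement because [`^] is total:
   it sends a negative base to [1]. *)
Definition App_weight (R : realType) d (X : measurableType d)
    (rho : X -> X -> R) (mu : {measure set X -> \bar R}) (p : R) (w : X -> R)
    : Prop :=
  (forall x, 0 < w x) /\ Ap_weight rho mu p (fun x => w x `^ p).

Definition conjugate_exponent (R : realType) (p : R) : R := p / (p - 1).

Definition bloom_weight (R : realType) (X : Type) (p q : R)
    (lambda1 lambda2 : X -> R) : X -> R :=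
  fun x => (lambda1 x / lambda2 x)
    `^ (p^-1 + (conjugate_exponent q)^-1)^-1.

(* [nuB] is a real number, hence [0] if the integral diverges; it is finite
   when [nu] is the Bloom weight above, by Hoelder's inequality. *)
Definition BMO_norm (R : realType) d (X : measurableType d)
    (rho : X -> X -> R) (mu : {measure set X -> \bar R})
    (alpha : R) (nu : X -> R) (b : X -> R[i]) : \bar R :=
  ereal_sup [set s | exists x (r : R), 0 < r /\
    let B := qball rho x r in
    let nuB : R := \int[mu]_(y in B) nu y in
    s = ((nuB `^ (- (alpha / doubling_order rho mu)))%:E * nuB^-1%:E *
         \int[mu]_(y in B) (cabs (b y - caverage mu B b))%:E)%E].

Definition in_BMO (R : realType) d (X : measurableType d)
    (rho : X -> X -> R) (mu : {measure set X -> \bar R})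
    (alpha : R) (nu : X -> R) (b : X -> R[i]) : Prop :=
  L1loc rho mu b /\ (BMO_norm rho mu alpha nu b < +oo)%E.

Record modulus (R : realType) (omega : R -> R) : Prop := Modulus {
  modulus_ge0 : forall t : R, 0 <= t <= 1 -> 0 <= omega t ;
  modulus_continuous : {within `[0, 1], continuous omega} ;
  modulus_increasing :
    forall s t : R, 0 <= s -> s <= t -> t <= 1 -> omega s <= omega t ;
  modulus_subadditive :
    forall s t : R, 0 <= s -> 0 <= t -> s + t <= 1 ->
      omega (s + t) <= omega s + omega t ;
  modulus0 : omega 0 = 0 }.

Definition Dini (R : realType) (omega : R -> R) : Prop :=
  (\int[@lebesgue_measure R]_(t in `]0%R, 1%R]) (omega t / t)%:E < +oo)%E.

Definition Vball (R : realType) d (X : measurableType d)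
    (rho : X -> X -> R) (mu : {measure set X -> \bar R}) (x y : X) : R :=
  fine (mu (qball rho x (rho x y))).

(* A kernel is a total function whose values on the diagonal are arbitrary.
   The condition [rho x x' < (2 A0)^-1 rho x y] forces [x != y] and
   [x' != y]. *)
Record CZ_kernel (R : realType) d (X : measurableType d)
    (rho : X -> X -> R) (A0 : R) (mu : {measure set X -> \bar R})
    (omega : R -> R) (K : X -> X -> R[i]) : Prop := CZKernel {
  CZ_kernel_modulus : modulus omega ;
  CZ_kernel_size : exists cK : R,
    forall x y, x <> y -> cabs (K x y) <= cK / Vball rho mu x y ;
  CZ_kernel_regularity : forall x x' y, rho x x' < (2 * A0)^-1 * rho x y ->
    cabs (K x y - K x' y) + cabs (K y x - K y x')
      <= (Vball rho mu x y)^-1 * omega (rho x x' / rho x y) }.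

Definition nondegenerate_kernel (R : realType) d (X : measurableType d)
    (rho : X -> X -> R) (mu : {measure set X -> \bar R})
    (K : X -> X -> R[i]) : Prop :=
  exists c0 Cbar : R, [/\ 0 < c0, 0 < Cbar &
    forall x (r : R), 0 < r ->
      exists y, [/\ qball rho x (Cbar * r) y, ~ qball rho x r y &
        (c0 * fine (mu (qball rho x r)))^-1 <= cabs (K x y)]].

(* Operators on [L^p] act on functions, all identities being almost
   everywhere; with linearity and boundedness this makes them compatible with
   almost everywhere equality. *)
Definition ae_linear_on (R : realType) d (X : measurableType d)
    (mu : {measure set X -> \bar R}) (F : (X -> R[i]) -> Prop)
    (T : (X -> R[i]) -> (X -> R[i])) : Prop :=
  forall (a : R[i]) f g, F f -> F g ->
    {ae mu, forall x, T (fun y => a * f y + g y) x = a * T f x + T g x}.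

Record CZ_operator (R : realType) d (X : measurableType d)
    (rho : X -> X -> R) (A0 : R) (mu : {measure set X -> \bar R})
    (omega : R -> R) (K : X -> X -> R[i]) (T : (X -> R[i]) -> (X -> R[i]))
    : Prop := CZOperator {
  CZ_operator_kernel : CZ_kernel rho A0 mu omega K ;
  CZ_operator_linear : ae_linear_on mu (in_Lp mu 2) T ;
  CZ_operator_measurable : forall f, in_Lp mu 2 f -> cmeasurable (T f) ;
  CZ_operator_bounded : exists C : R, forall f, in_Lp mu 2 f ->
    (Lp_norm mu 2 (fun=> 1%R) (T f) <= C%:E * Lp_norm mu 2 (fun=> 1%R) f)%E ;
  CZ_operator_formula : forall f, in_Lp mu 2 f ->
    {ae mu, forall x, ~ qsupport rho f x ->
      T f x = cintegral mu setT (fun y => K x y * f y)} }.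

(* [T1] is the bounded extension [L^1 -> L^{1,oo}] of [T], which is unique
   up to almost everywhere equality. *)
Record weak_L1_extension (R : realType) d (X : measurableType d)
    (mu : {measure set X -> \bar R}) (T T1 : (X -> R[i]) -> (X -> R[i]))
    : Prop := WeakL1Extension {
  weak_L1_extends : forall f, in_Lp mu 1 f -> in_Lp mu 2 f ->
    {ae mu, forall x, T1 f x = T f x} ;
  weak_L1_linear : ae_linear_on mu (in_Lp mu 1) T1 ;
  weak_L1_measurable : forall f, in_Lp mu 1 f -> cmeasurable (T1 f) ;
  weak_L1_bounded : exists C : R, forall f, in_Lp mu 1 f ->
    forall t : R, 0 < t ->
      (t%:E * mu [set x | (t < cabs (T1 f x))%R]
         <= C%:E * Lp_norm mu 1 (fun=> 1%R) f)%E }.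

(* For [b] locally integrable and [f] in [Linfty_bs], [f] is in [L^2] while
   [b f] is only in [L^1], where [T] is replaced by its extension [T1]. *)
Definition commutator (R : realType) (X : Type)
    (T T1 : (X -> R[i]) -> (X -> R[i])) (b f : X -> R[i]) : X -> R[i] :=
  fun x => b x * T f x - T1 (fun y => b y * f y) x.

Definition operator_bound (R : realType) d (X : measurableType d)
    (rho : X -> X -> R) (mu : {measure set X -> \bar R})
    (p : R) (w1 : X -> R) (q : R) (w2 : X -> R)
    (S : (X -> R[i]) -> (X -> R[i])) (Theta : R) : Prop :=
  0 <= Theta /\
  forall f, Linfty_bs rho f ->
    (Lp_norm mu q w2 (S f) <= Theta%:E * Lp_norm mu p w1 f)%E.

Definition bounded_operator (R : realType) d (X : measurableType d)
    (rho : X -> X -> R) (mu : {measure set X -> \bar R})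
    (p : R) (w1 : X -> R) (q : R) (w2 : X -> R)
    (S : (X -> R[i]) -> (X -> R[i])) : Prop :=
  exists Theta : R, operator_bound rho mu p w1 q w2 S Theta.

Definition operator_norm (R : realType) d (X : measurableType d)
    (rho : X -> X -> R) (mu : {measure set X -> \bar R})
    (p : R) (w1 : X -> R) (q : R) (w2 : X -> R)
    (S : (X -> R[i]) -> (X -> R[i])) : R :=
  inf [set Theta : R | operator_bound rho mu p w1 q w2 S Theta].

(* Main.v *)
(* Fix a ball B = B(x0, r). Non-degeneracy at radius A r gives y0 such that, for A
   large, K is within 5% of the constant k = K(x0, y0) on B x E, E = B(y0, r).
   For f supported in E the commutator at x in B is then
   k (b(x) \int f - \int b f) up to an error controlled by
   D = mu(E) \int_B |b - c| + mu(B) \int_E |b - c|, where c is the mean of b on E.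
   Taking for f the indicator of E and its products with the signs of Re (b - c)
   and Im (b - c) recovers D itself, and the error is absorbed; integrating only
   over B avoids any joint measurability of K. By Hoelder,
   |k| D <= 10 Theta lambda1^p(E)^(1/p) lambda2^(-q')(B)^(1/q'), and the A_p and
   A_q conditions together with a three-function Hoelder inequality bound the
   product of weights by a multiple of nu(B)^(1/p + 1/q'). The formula for T1 (b f)
   off the support, b f being only in L^1, comes from truncating b f and the weak
   type bound. *)
Require Import Defs.
From mathcomp Require Import all_boot all_order all_algebra.
From mathcomp Require Import all_classical all_reals all_analysis.
From mathcomp Require Import measurable_realfun.
From mathcomp Require Import ring lra.
Set Implicit Arguments.
Unset Strict Implicit.
Unset Printing Implicit Defensive.
Import Order.TTheory GRing.Theory Num.Theory.
Import numFieldNormedType.Exports.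
Local Open Scope classical_set_scope.
Local Open Scope ring_scope.

(** * Complex-valued functions and their integrals *)

Section complex_valued_functions.
Context (R : realType).
Implicit Types z w : R[i].

(** The oscillation of [b] on B cannot be bounded alone: replacing K by k leaves an error that
    involves B and E alike, so both oscillations are bounded together. If tau bounds the integral
    over B of the commutator of each test function, the three test functions give |k| D <= 5 tau +
    10 eps |k| D. With eps = 1/20 the last term is half of the left side, and it can be subtracted
    because D is finite, b being locally integrable. Exchanging the mean on E for the mean on B
    costs a factor 3, whence the constant 30. The exponents fit because alpha / Q + 1 = 1/p - 1/q +
    1 = 1/p + 1/q', the power of nu(B) produced by the weights. The weight lambda1^p is integrated
    over a dilate of B that contains E, so that the dual weight in A_p also controls its integral
    over B. Two features of the setting shape the details. Balls of a quasi-metric need not be open,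
    so being off a support requires an open set inside a ball. All identities for T and T1 hold only
    almost everywhere, with exceptional sets depending on the function. *)

Lemma ReD z w : complex.Re (z + w) = complex.Re z + complex.Re w.
Proof. by case: z w => [a b] [c e]. Qed.

Lemma ImD z w : complex.Im (z + w) = complex.Im z + complex.Im w.
Proof. by case: z w => [a b] [c e]. Qed.

Lemma ReB z w : complex.Re (z - w) = complex.Re z - complex.Re w.
Proof. by case: z w => [a b] [c e]. Qed.

Lemma ImB z w : complex.Im (z - w) = complex.Im z - complex.Im w.
Proof. by case: z w => [a b] [c e]. Qed.

Lemma ReM z w : complex.Re (z * w) =
  complex.Re z * complex.Re w - complex.Im z * complex.Im w.
Proof. by case: z w => [a b] [c e]. Qed.

Lemma ImM z w : complex.Im (z * w) =
  complex.Re z * complex.Im w + complex.Im z * complex.Re w.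
Proof. by case: z w => [a b] [c e]. Qed.

Definition ReImE := (ReD, ImD, ReB, ImB, ReM, ImM).

Lemma cabsE z : cabs z = Num.sqrt (complex.Re z ^+ 2 + complex.Im z ^+ 2).
Proof. by case: z. Qed.

Lemma complexP z w :
  complex.Re z = complex.Re w -> complex.Im z = complex.Im w -> z = w.
Proof. by case: z w => [a b] [c e] /= -> ->. Qed.

Lemma cabs_ge0 z : 0 <= cabs z.
Proof. by rewrite cabsE sqrtr_ge0. Qed.

Lemma cabs0 : cabs (0 : R[i]) = 0.
Proof. exact: ComplexField.Normc.normc0. Qed.

Lemma cabs_eq0 z : cabs z = 0 -> z = 0.
Proof. exact: ComplexField.Normc.eq0_normc. Qed.

Lemma cabsM z w : cabs (z * w) = cabs z * cabs w.
Proof. exact: ComplexField.Normc.normcM. Qed.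

Lemma cabsN z : cabs (- z) = cabs z.
Proof. by case: z => a b; rewrite !cabsE /= !sqrrN. Qed.

Lemma cabsB z w : cabs (z - w) = cabs (w - z).
Proof. by rewrite -cabsN opprB. Qed.

Lemma cabs_real (a : R) : cabs (Complex a 0) = `|a|.
Proof. by rewrite cabsE /= expr0n addr0 sqrtr_sqr. Qed.

Lemma cabsD z w : cabs (z + w) <= cabs z + cabs w.
Proof.
have := ComplexField.lec_normD z w.
by rewrite /ComplexField.lec /= => /andP[].
Qed.

Lemma cabs_triangle z w v : cabs (z - w) <= cabs (z - v) + cabs (v - w).
Proof. by apply: le_trans (cabsD _ _); rewrite addrA subrK. Qed.

Lemma normr_Re_cabs z : `|complex.Re z| <= cabs z.
Proof.
by rewrite cabsE -sqrtr_sqr ler_wsqrtr// lerDl sqr_ge0.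
Qed.

Lemma normr_Im_cabs z : `|complex.Im z| <= cabs z.
Proof.
by rewrite cabsE -sqrtr_sqr ler_wsqrtr// lerDr sqr_ge0.
Qed.

Lemma cabs_ReIm z : cabs z <= `|complex.Re z| + `|complex.Im z|.
Proof.
rewrite cabsE -[leRHS]ger0_norm ?addr_ge0// -[leRHS]sqrtr_sqr ler_wsqrtr//.
rewrite -(real_normK (num_real (complex.Re z))).
rewrite -(real_normK (num_real (complex.Im z))).
rewrite sqrrD addrAC lerDl mulrn_wge0// mulr_ge0//.
Qed.

End complex_valued_functions.

Section complex_integral.
Context (R : realType) d (X : measurableType d).
Variable mu : {measure set X -> \bar R}.
Implicit Types (D E : set X) (f g : X -> R[i]).

(** Relative to a set, because a section [K x] of the kernel is controlled only away from the point
    [x]. *)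
Definition cmeasurable_on D f : Prop :=
  measurable_fun D (fun x => complex.Re (f x)) /\
  measurable_fun D (fun x => complex.Im (f x)).

Definition cintegrable D f : Prop :=
  cmeasurable_on D f /\ (\int[mu]_(x in D) (cabs (f x))%:E < +oo)%E.

Lemma cmeasurable_onW D f : measurable D -> cmeasurable f -> cmeasurable_on D f.
Proof. by move=> mD [f1 f2]; split; apply: (measurable_funS measurableT). Qed.

Lemma cmeasurable_onM D f g : cmeasurable_on D f -> cmeasurable_on D g ->
  cmeasurable_on D (fun x => f x * g x).
Proof.
move=> [f1 f2] [g1 g2]; split.
  under eq_fun do rewrite ReM.
  by apply: measurable_funB; apply: measurable_funM.
under eq_fun do rewrite ImM.
by apply: measurable_funD; apply: measurable_funM.
Qed.

Lemma cmeasurable_onD D f g : cmeasurable_on D f -> cmeasurable_on D g ->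
  cmeasurable_on D (fun x => f x + g x).
Proof.
move=> [f1 f2] [g1 g2]; split; [under eq_fun do rewrite ReD|
  under eq_fun do rewrite ImD]; exact: measurable_funD.
Qed.

Lemma cmeasurable_onB D f g : cmeasurable_on D f -> cmeasurable_on D g ->
  cmeasurable_on D (fun x => f x - g x).
Proof.
move=> [f1 f2] [g1 g2]; split; [under eq_fun do rewrite ReB|
  under eq_fun do rewrite ImB]; exact: measurable_funB.
Qed.

Lemma cmeasurable_on_cst D (c : R[i]) : cmeasurable_on D (fun=> c).
Proof. by split; exact: measurable_cst. Qed.

Lemma cmeasurable_on_real D (s : X -> R) : measurable_fun D s ->
  cmeasurable_on D (fun x => Complex (s x) 0).
Proof. by move=> ms; split => //=; exact: measurable_cst. Qed.

Lemma measurable_cabs D f : cmeasurable_on D f ->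
  measurable_fun D (fun x => cabs (f x)).
Proof.
move=> [f1 f2]; under eq_fun do rewrite cabsE.
have mS : measurable_fun setT (@Num.sqrt R).
  apply: continuous_measurable_fun; exact: sqrt_continuous.
apply: (measurableT_comp mS).
by apply: measurable_funD; exact: measurable_funX.
Qed.

Lemma cintegrable_cabs D f : cintegrable D f ->
  mu.-integrable D (EFin \o (fun x => cabs (f x))).
Proof.
move=> [mf foo]; apply/integrableP; split.
  by apply/measurable_EFinP; exact: measurable_cabs.
by under eq_integral do rewrite /= ger0_norm ?cabs_ge0//.
Qed.

Lemma cintegrable_le D f (h : X -> R) : measurable D -> cmeasurable_on D f ->
  mu.-integrable D (EFin \o h) -> (forall x, D x -> cabs (f x) <= h x) ->
  cintegrable D f.
Proof.
move=> mD mf ih fh; split => //.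
have : mu.-integrable D (EFin \o (fun x => cabs (f x))).
  apply: (le_integrable mD _ _ ih).
    by apply/measurable_EFinP; exact: measurable_cabs.
  move=> x Dx /=; rewrite lee_fin !ger0_norm ?cabs_ge0//; first exact: fh.
  exact: le_trans (cabs_ge0 _) (fh _ Dx).
move=> /integrableP[_].
by under eq_integral do rewrite /= ger0_norm ?cabs_ge0//.
Qed.

Lemma cintegrable_Re D f : measurable D -> cintegrable D f ->
  mu.-integrable D (EFin \o (fun x => complex.Re (f x))).
Proof.
move=> mD fi; have := fi.1.1 => mf.
apply: (le_integrable mD _ _ (cintegrable_cabs fi)) => //.
  exact/measurable_EFinP.
move=> x _ /=; rewrite lee_fin (ger0_norm (cabs_ge0 _)).
exact: normr_Re_cabs.
Qed.

Lemma cintegrable_Im D f : measurable D -> cintegrable D f ->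
  mu.-integrable D (EFin \o (fun x => complex.Im (f x))).
Proof.
move=> mD fi; have := fi.1.2 => mf.
apply: (le_integrable mD _ _ (cintegrable_cabs fi)) => //.
  exact/measurable_EFinP.
move=> x _ /=; rewrite lee_fin (ger0_norm (cabs_ge0 _)).
exact: normr_Im_cabs.
Qed.

Lemma cintegrableB D f g : measurable D -> cintegrable D f -> cintegrable D g ->
  cintegrable D (fun x => f x - g x).
Proof.
move=> mD fi gi.
apply: (@cintegrable_le _ _ (fun x => cabs (f x) + cabs (g x))) => //.
- exact: cmeasurable_onB fi.1 gi.1.
- exact: integrableD (cintegrable_cabs fi) (cintegrable_cabs gi).
- by move=> x _; rewrite -[cabs (g x)]cabsN; exact: cabsD.
Qed.

Lemma cintegrableMl D f g (M : R) : measurable D -> cmeasurable_on D f ->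
  (forall x, D x -> cabs (f x) <= M) -> cintegrable D g ->
  cintegrable D (fun x => f x * g x).
Proof.
move=> mD mf fM gi.
apply: (@cintegrable_le _ _ (fun x => M * cabs (g x))) => //.
- exact: cmeasurable_onM mf gi.1.
- exact: integrableZl (cintegrable_cabs gi).
- by move=> x Dx; rewrite cabsM ler_wpM2r ?cabs_ge0//; exact: fM.
Qed.

Lemma cintegrable_bounded D f (M : R) : measurable D -> (mu D < +oo)%E ->
  cmeasurable_on D f -> (forall x, D x -> cabs (f x) <= M) -> cintegrable D f.
Proof.
move=> mD fD mf fM; apply: (@cintegrable_le _ _ (fun=> M)) => //.
apply/integrableP; split; first exact: measurable_cst.
by rewrite /= integral_cst// lte_mul_pinfty.
Qed.

Lemma cintegralB D f g : measurable D -> cintegrable D f -> cintegrable D g ->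
  cintegral mu D (fun x => f x - g x) = cintegral mu D f - cintegral mu D g.
Proof.
move=> mD fi gi; apply: complexP; rewrite !ReImE /=.
  under eq_Rintegral do rewrite ReB.
  by apply: RintegralB => //; exact: cintegrable_Re.
under eq_Rintegral do rewrite ImB.
by apply: RintegralB => //; exact: cintegrable_Im.
Qed.

Lemma cintegralD D f g : measurable D -> cintegrable D f -> cintegrable D g ->
  cintegral mu D (fun x => f x + g x) = cintegral mu D f + cintegral mu D g.
Proof.
move=> mD fi gi; apply: complexP; rewrite !ReImE /=.
  under eq_Rintegral do rewrite ReD.
  by apply: RintegralD => //; exact: cintegrable_Re.
under eq_Rintegral do rewrite ImD.
by apply: RintegralD => //; exact: cintegrable_Im.
Qed.

Lemma cintegralZl D f (c : R[i]) : measurable D -> cintegrable D f ->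
  cintegral mu D (fun x => c * f x) = c * cintegral mu D f.
Proof.
move=> mD fi.
have iR := cintegrable_Re mD fi; have iI := cintegrable_Im mD fi.
have iZ (a : R) (h : X -> R) : mu.-integrable D (EFin \o h) ->
  mu.-integrable D (EFin \o (fun x => a * h x)).
  by move=> ih; have := integrableZl mD a ih.
apply: complexP; rewrite !ReImE /=.
  under eq_Rintegral do rewrite ReM.
  by rewrite RintegralB ?RintegralZl//; exact: iZ.
under eq_Rintegral do rewrite ImM.
by rewrite RintegralD ?RintegralZl//; exact: iZ.
Qed.

Lemma eq_cintegral D f g : {in D, f =1 g} ->
  cintegral mu D f = cintegral mu D g.
Proof.
by move=> fg; apply: complexP => /=; apply: eq_Rintegral => x xD; rewrite fg.
Qed.

Lemma cintegral_real D (s : X -> R) :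
  cintegral mu D (fun x => Complex (s x) 0) = Complex (\int[mu]_(x in D) s x) 0.
Proof.
apply: complexP => //=.
by rewrite -[RHS](Rintegral_set0 mu (fun=> 0%R)) /Rintegral integral0
  integral_set0.
Qed.

Lemma cintegral_cst D (c : R[i]) : measurable D ->
  cintegral mu D (fun=> c) = Complex (fine (mu D)) 0 * c.
Proof.
move=> mD; apply: complexP; rewrite !ReImE /= Rintegral_cst// mul0r;
  by rewrite ?subr0 ?addr0 mulrC.
Qed.

Lemma cintegralT D f : measurable D -> (forall x, ~ D x -> f x = 0) ->
  cintegral mu setT f = cintegral mu D f.
Proof.
move=> mD f0; apply: complexP => /=; rewrite [RHS]Rintegral_mkcond;
  apply: eq_Rintegral => x _; rewrite patchE; case: ifPn => //;
  by rewrite notin_setE => /f0 ->.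
Qed.

(** Real and imaginary parts are estimated separately, whence the factor 2 instead of the sharp 1;
    it only affects the constants. *)
Lemma cabs_cintegral D f : measurable D -> cintegrable D f ->
  cabs (cintegral mu D f) <= 2 * \int[mu]_(x in D) cabs (f x).
Proof.
move=> mD fi; apply: le_trans (cabs_ReIm _) _; rewrite /= mulr_natl mulr2n.
have ia := cintegrable_cabs fi.
apply: lerD.
  apply: le_trans (le_normr_Rintegral mD (cintegrable_Re mD fi)) _.
  apply: le_Rintegral => //; first exact: integrable_norm (cintegrable_Re mD fi).
  by move=> x _; exact: normr_Re_cabs.
apply: le_trans (le_normr_Rintegral mD (cintegrable_Im mD fi)) _.
apply: le_Rintegral => //; first exact: integrable_norm (cintegrable_Im mD fi).
by move=> x _; exact: normr_Im_cabs.
Qed.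

End complex_integral.

(** * Quasi-metric topology, doubling and kernels *)

Section quasi_metric_topology.
Context (R : realType) (X : Type) (rho : X -> X -> R) (A0 : R).
Hypothesis hrho : quasi_metric rho A0.

Lemma qmetric_A0_gt0 : 0 < A0.
Proof. exact: lt_le_trans ltr01 (qmetric_A0_ge1 hrho). Qed.

Lemma qmetric_xx x : rho x x = 0.
Proof. exact/(qmetric_eq0 hrho). Qed.

(* Points reachable from [x] in [n] steps, the i-th of length less than
   [s / (2 A0)^i]; the geometric decay keeps them all in the ball of radius [s],
   although balls need not be open. *)
Fixpoint qchain (n : nat) (s : R) (x y : X) : Prop :=
  if n is n'.+1 then
    exists2 z, rho x z < s / (2 * A0) & qchain n' (s / (2 * A0)) z y
  else y = x.

Lemma qchain_lt n s x y : 0 < s -> qchain n s x y -> rho x y < s.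
Proof.
elim: n s x => [|n IH] s x s0 /=; first by move=> ->; rewrite qmetric_xx.
move=> [z xz zy]; have A00 := qmetric_A0_gt0.
have s'0 : 0 < s / (2 * A0) by rewrite divr_gt0// mulr_gt0.
apply: le_lt_trans (qmetric_triangle hrho x y z) _.
have -> : s = A0 * (s / (2 * A0) + s / (2 * A0)) by field; rewrite gt_eqF.
by rewrite ltr_pM2l// ltrD//; exact: IH zy.
Qed.

(** A chain can be prolonged by one step to every point of a small ball around its endpoint; this
    makes the set of reachable points open. *)
Lemma qchain_ball n s x y : 0 < s -> qchain n s x y ->
  exists2 e, 0 < e & forall z, rho y z < e -> qchain n.+1 s x z.
Proof.
have A00 := qmetric_A0_gt0.
elim: n s x => [|n IH] s x s0.
  move=> /= ->; exists (s / (2 * A0)); first by rewrite divr_gt0// mulr_gt0.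
  by move=> z xz; exists z.
move=> [z xz zy]; have s'0 : 0 < s / (2 * A0) by rewrite divr_gt0// mulr_gt0.
have [e e0 he] := IH _ _ s'0 zy; exists e => // w yw.
by exists z => //; exact: he.
Qed.

Lemma qball_nbhs x s : 0 < s ->
  exists U, [/\ qopen rho U, U x & U `<=` qball rho x s].
Proof.
move=> s0; exists [set y | exists n, qchain n s x y]; split.
- move=> y [n /(qchain_ball s0)[e e0 he]]; exists e => // z yz.
  by exists n.+1; exact: he.
- by exists 0%N.
- by move=> y [n /(qchain_lt s0)].
Qed.

(** The closure is tested by open sets and the ball of radius [s] may fail to be one; the open set
    found inside it separates [x] from [A]. *)
Lemma notin_qclosure (A : set X) x s : 0 < s ->
  (forall y, A y -> s <= rho x y) -> ~ qclosure rho A x.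
Proof.
move=> s0 sA Ax; have [U [oU Ux Us]] := qball_nbhs x s0.
have [y [Uy Ay]] := Ax U oU Ux.
by have := Us y Uy; rewrite /qball /= ltNge sA.
Qed.

End quasi_metric_topology.

(** * Measures of balls and Borel measurability *)

Section homogeneous_spaces.
Context (R : realType) d (X : measurableType d) (rho : X -> X -> R) (A0 : R)
  (mu : {measure set X -> \bar R}).
Hypothesis hX : homogeneous_space rho A0 mu.

Local Notation m x r := (fine (mu (qball rho x r))).

Let hrho := hspace_qmetric hX.

Lemma qball_fin_num x r : 0 < r -> mu (qball rho x r) \is a fin_num.
Proof. by move=> r0; rewrite ge0_fin_numE// (hspace_ball_fin hX). Qed.

Lemma qball_fineK x r : 0 < r -> (m x r)%:E = mu (qball rho x r).
Proof. by move=> r0; rewrite fineK// qball_fin_num. Qed.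

Lemma fine_qball_gt0 x r : 0 < r -> 0 < m x r.
Proof. by move=> r0; rewrite -lte_fin qball_fineK// (hspace_ball_gt0 hX). Qed.

Lemma fine_qball_le x r y s : 0 < r -> 0 < s ->
  qball rho x r `<=` qball rho y s -> m x r <= m y s.
Proof.
move=> r0 s0 xy; rewrite -lee_fin !qball_fineK//; apply: le_measure => //;
  by rewrite inE; exact: hspace_ball_measurable hX _ _ _.
Qed.

Lemma fine_qball_leW x r s : 0 < r -> r <= s -> m x r <= m x s.
Proof.
move=> r0 rs; apply: fine_qball_le => //; first exact: lt_le_trans rs.
by move=> y; rewrite /qball /= => /lt_le_trans; exact.
Qed.

Lemma doubling_iter (lam : R) : 0 < lam -> exists2 C, 0 < C &
  forall x r, 0 < r -> m x (lam * r) <= C * m x r.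
Proof.
move=> lam0; have [C hC] := hspace_doubling hX.
pose C1 := Num.max C 1.
have C11 : 1 <= C1 by rewrite le_max lexx orbT.
have C10 : 0 < C1 by exact: lt_le_trans C11.
have C1d x r : 0 < r -> m x (2 * r) <= C1 * m x r.
  move=> r0; have r20 : 0 < 2 * r by rewrite mulr_gt0.
  have := hC x r r0; rewrite -(qball_fineK x r0) -(qball_fineK x r20).
  rewrite -EFinM lee_fin => /le_trans; apply.
  by apply: ler_wpM2r; [exact/ltW/fine_qball_gt0|rewrite le_max lexx].
have C1n n x r : 0 < r -> m x (2 ^+ n * r) <= C1 ^+ n * m x r.
  elim: n r => [|n IH] r r0; first by rewrite !expr0 !mul1r.
  rewrite !exprS -mulrA; apply: le_trans (C1d _ _ _) _.
    by rewrite mulr_gt0// exprn_gt0.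
  by rewrite -mulrA ler_pM2l// IH.
pose n := Num.bound lam.
have lamn : lam <= 2 ^+ n.
  apply: (@le_trans _ _ n%:R).
    exact/ltW/archi_boundP/ltW.
  by rewrite -natrX ler_nat ltnW// ltn_expl.
exists (C1 ^+ n); first by rewrite exprn_gt0.
move=> x r r0; apply: le_trans (C1n n x r r0).
apply: fine_qball_leW; first by rewrite mulr_gt0.
by rewrite ler_pM2r.
Qed.

Lemma qopen_measurable U : qopen rho U -> measurable U.
Proof. by move=> oU; rewrite (hspace_borel hX); exact: sub_gen_smallest. Qed.

(** Inside [O] the superlevel sets are open, hence Borel. Continuity is asked on [O] only, so that
    the diagonal singularity of a kernel can be left out. *)
Lemma qcontinuous_measurable (O D : set X) (f : X -> R) :
  qopen rho O -> measurable D -> D `<=` O ->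
  (forall x, O x -> forall e, 0 < e ->
    exists2 s, 0 < s & forall y, rho x y < s -> `|f x - f y| < e) ->
  measurable_fun D f.
Proof.
move=> oO mD DO cf _.
apply: (measurability _ (RGenOInfty.measurableE R)) => //= _ [_ [a ->] <-].
have -> : D `&` f @^-1` `]a, +oo[ = D `&` (O `&` f @^-1` `]a, +oo[).
  by rewrite setIA (setIidl DO).
apply: measurableI => //; apply: qopen_measurable => x [Ox].
rewrite /= in_itv /= andbT => afx.
have [s1 s10 hs1] := oO x Ox.
have [|s2 s20 hs2] := cf x Ox (f x - a); first by rewrite subr_gt0.
exists (Num.min s1 s2); first by rewrite lt_min s10.
move=> y; rewrite /qball /= lt_min => /andP[xy1 xy2]; split; first exact: hs1.
rewrite /= in_itv /= andbT.
by have := hs2 y xy2; rewrite ltr_norml => /andP[_]; rewrite ltrD2l ltrN2.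
Qed.

End homogeneous_spaces.

(** * Continuity and near constancy of the kernel *)

Section kernels.
Context (R : realType) d (X : measurableType d) (rho : X -> X -> R) (A0 : R)
  (mu : {measure set X -> \bar R}) (omega : R -> R) (K : X -> X -> R[i]).
Hypothesis hX : homogeneous_space rho A0 mu.
Hypothesis hK : CZ_kernel rho A0 mu omega K.

Local Notation m x r := (fine (mu (qball rho x r))).

Let hrho := hspace_qmetric hX.
Let homega := CZ_kernel_modulus hK.

(** Right continuity at [0], where [omega] vanishes; the point [t = 0] is treated apart because the
    one-sided limit does not see it. *)
Lemma modulus_small (e : R) : 0 < e -> exists2 t0, 0 < t0 &
  forall t, 0 <= t <= t0 -> t <= 1 -> omega t <= e.
Proof.
move=> e0.
have [_ + _] := (continuous_within_itvP _ ltr01).1 (modulus_continuous homega).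
rewrite (modulus0 homega) => /cvgrPdist_le /(_ e e0).
move=> [t0 /= t00 ht0]; exists (t0 / 2); first by rewrite divr_gt0.
move=> t /andP[]; rewrite le_eqVlt => /predU1P[<- _ _|tgt0 tt0 t1].
  by rewrite (modulus0 homega) ltW.
have := ht0 t; rewrite /= sub0r !normrN gtr0_norm//.
have lt_t : t < t0 by apply: le_lt_trans tt0 _; rewrite ltr_pdivrMr// ltr_pMr// ltr1n.
by move=> /(_ lt_t tgt0); rewrite sub0r normrN => h; apply: le_trans (ler_norm _) h.
Qed.

(** The regularity condition makes [K x] continuous on the complement of [x], which is open. *)
Lemma kernel_measurable x D : measurable D -> ~ D x -> cmeasurable_on D (K x).
Proof.
move=> mD Dx.
have A00 := qmetric_A0_gt0 hrho.
have oO : qopen rho [set y | y <> x].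
  move=> y yx; exists (rho y x).
    rewrite lt_neqAle (qmetric_ge0 hrho) andbT eq_sym; apply/eqP.
    by move/(qmetric_eq0 hrho).
  by move=> z /= + zx; rewrite /qball /= zx ltxx.
have cK y : y <> x -> forall e, 0 < e ->
    exists2 s, 0 < s & forall z, rho y z < s -> cabs (K x y - K x z) < e.
  move=> yx e e0.
  have dyx : 0 < rho y x.
    rewrite lt_neqAle (qmetric_ge0 hrho) andbT eq_sym; apply/eqP.
    by move/(qmetric_eq0 hrho).
  pose V := Vball rho mu y x.
  have V0 : 0 < V by exact: fine_qball_gt0 hX _ _ dyx.
  have [|t0 t00 ht0] := @modulus_small (e * V / 2).
    by rewrite divr_gt0// mulr_gt0.
  (* The first bound makes [omega] small, the second puts [z] within the range of the regularity
     condition. *)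
  pose t1 := Num.min t0 (2 * A0)^-1.
  have t10 : 0 < t1 by rewrite lt_min t00 invr_gt0 mulr_gt0.
  exists (t1 * rho y x); first by rewrite mulr_gt0.
  move=> z yz.
  have yz1 : rho y z < (2 * A0)^-1 * rho y x.
    by apply: lt_le_trans yz _; rewrite ler_pM2r// ge_min lexx orbT.
  have := CZ_kernel_regularity hK yz1 => h.
  have : cabs (K x y - K x z) <= V^-1 * omega (rho y z / rho y x).
    by apply: le_trans h; rewrite lerDr cabs_ge0.
  move=> /le_lt_trans; apply.
  rewrite mulrC ltr_pdivrMr//; apply: (@le_lt_trans _ _ (e * V / 2)); last first.
    by rewrite ltr_pdivrMr// ltr_pMr ?mulr_gt0// ltr1n.
  apply: ht0; last first.
    rewrite ler_pdivrMr// mul1r ltW//; apply: lt_le_trans yz1 _.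
    apply: ler_piMl; [exact: ltW|rewrite invf_le1 ?mulr_gt0//].
    by have := qmetric_A0_ge1 hrho; lra.
  rewrite divr_ge0 ?(qmetric_ge0 hrho)//= ler_pdivrMr//.
  by apply/ltW/(lt_le_trans yz); rewrite ler_pM2r// ge_min lexx.
split; apply: (qcontinuous_measurable hX oO mD).
- by move=> y Dy /= yx; apply: Dx; rewrite -yx.
- move=> y yx e e0; have [s s0 hs] := cK y yx e e0; exists s => // z /hs.
  by apply: le_lt_trans; rewrite -ReB normr_Re_cabs.
- by move=> y Dy /= yx; apply: Dx; rewrite -yx.
- move=> y yx e e0; have [s s0 hs] := cK y yx e e0; exists s => // z /hs.
  by apply: le_lt_trans; rewrite -ImB normr_Im_cabs.
Qed.

(* For [y0] at distance about [A r] from [x0] with [K x0 y0] of maximal size,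
   [K] is almost constant on the product of the balls of radius [r] when [A] is
   large, as the relative variation is [O(omega (2 A0 / A))]. *)
Lemma kernel_almost_constant (eps : R) : nondegenerate_kernel rho mu K ->
  0 < eps -> exists L Cm : R, [/\ 0 < L, 0 < Cm &
    forall x0 r, 0 < r -> exists y0, [/\ rho x0 y0 < L * r,
      (Cm * m x0 r)^-1 <= cabs (K x0 y0) &
      forall x y, rho x0 x < r -> rho y0 y < r ->
        r <= rho x y /\ cabs (K x y - K x0 y0) <= eps * cabs (K x0 y0)]].
Proof.
move=> [c0 [Cbar [c00 Cbar0 hnd]]] eps0.
have A01 := qmetric_A0_ge1 hrho.
have A00 := qmetric_A0_gt0 hrho.
have A020 : 0 < 2 * A0 by rewrite mulr_gt0.
have [C2 C20 hC2] := doubling_iter hX A020.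
(* Moving [x] and moving [y] may each cost half of [eps]; the factor [C2 * c0] is the price of
   bounding [1 / V] by [cabs (K x0 y0)]. *)
have [|t0 t00 ht0] := @modulus_small (eps / (2 * C2 * c0)).
  by rewrite divr_gt0// !mulr_gt0.
(* The term [5 * A0 ^+ 2] keeps the two balls at distance at least [r] and validates both regularity
   conditions; [2 * A0 / t0] makes the arguments of [omega], at most [2 * A0 / A], smaller than
   [t0]. *)
pose A := Num.max (5 * A0 ^+ 2) (2 * A0 / t0).
have A5 : 5 * A0 ^+ 2 <= A by rewrite le_max lexx.
have At : 2 * A0 / t0 <= A by rewrite le_max lexx orbT.
have Agt0 : 0 < A by apply: lt_le_trans A5; rewrite mulr_gt0// exprn_gt0.
have [CA CA0 hCA] := doubling_iter hX Agt0.
exists (Cbar * A), (c0 * CA); split; [exact: mulr_gt0|exact: mulr_gt0|].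
move=> x0 r r0; have Ar0 : 0 < A * r by rewrite mulr_gt0.
have [y0 [xy0 /negP]] := hnd x0 _ Ar0; rewrite -leNgt => xyA Kge.
exists y0; split.
- by rewrite -mulrA.
- apply: le_trans Kge; rewrite lef_pV2 ?posrE ?mulr_gt0 ?(fine_qball_gt0 hX)//.
  by rewrite -mulrA ler_pM2l// hCA.
move=> x y x0x y0y.
have tri1 := qmetric_triangle hrho x0 y0 x.
have tri2 := qmetric_triangle hrho x y0 y.
have tri3 := qmetric_triangle hrho x0 y0 y.
rewrite (qmetric_sym hrho y y0) in tri2 tri3.
have A5r : 5 * A0 ^+ 2 * r <= rho x0 y0.
  by apply: le_trans xyA; rewrite ler_pM2r.
split.
  have : 5 * A0 ^+ 2 * r <= A0 * (r + A0 * (rho x y + r)).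
    apply: le_trans A5r (le_trans tri1 _).
    rewrite ler_pM2l// lerD ?ltW//; apply: le_lt_trans tri2 _.
    by rewrite ltr_pM2l// ltrD2l.
  rewrite expr2 mulrCA -!mulrA ler_pM2l// => h.
  have : 5 * (A0 * r) <= A0 * r + A0 * (rho x y + r).
    by apply: le_trans (_ : _ <= r + A0 * (rho x y + r)) _;
      [nra | rewrite lerD2r ler_peMl// ltW].
  by nra.
have d0 : 0 < rho x0 y0 by exact: lt_le_trans xyA.
have hy : A * r / (2 * A0) <= rho x0 y.
  rewrite ler_pdivrMr//.
  have : A * r <= A0 * (rho x0 y + r).
    apply: le_trans xyA (le_trans tri3 _).
    by rewrite ler_pM2l// lerD2l ltW.
  have : 2 * A0 * r <= A * r by rewrite ler_pM2r//; nra.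
  by nra.
have hy0 : 0 < rho x0 y by apply: lt_le_trans hy; rewrite divr_gt0.
(* The measures [V] in the two regularity bounds dominate that of the ball of radius [A * r] about
   [x0], at which non-degeneracy was applied. *)
have V1 : m x0 (A * r) <= C2 * Vball rho mu x0 y.
  have -> : A * r = 2 * A0 * (A * r / (2 * A0)) by field; rewrite gt_eqF.
  apply: le_trans (hC2 _ _ _) _; first by rewrite divr_gt0.
  rewrite ler_pM2l//; apply: (fine_qball_leW hX) => //.
  by rewrite divr_gt0.
have V2 : m x0 (A * r) <= C2 * Vball rho mu y0 x0.
  rewrite /Vball (qmetric_sym hrho y0 x0); apply: le_trans (hC2 _ _ d0).
  apply: (fine_qball_le hX) => //; first by rewrite mulr_gt0.
  move=> z; rewrite /qball /= => x0z.
  apply: le_lt_trans (qmetric_triangle hrho y0 z x0) _.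
  by rewrite (qmetric_sym hrho y0 x0) mulrAC (mulrC (2 * _)) ltr_pM2l//; lra.
have V10 : 0 < Vball rho mu x0 y by exact: fine_qball_gt0 hX _ _ hy0.
have V20 : 0 < Vball rho mu y0 x0.
  by apply: (fine_qball_gt0 hX); rewrite (qmetric_sym hrho).
have mA0 := fine_qball_gt0 hX x0 Ar0.
pose k := cabs (K x0 y0).
(* Non-degeneracy turns [1 / V] into a multiple of [k], so that the error is relative to the size of
   the kernel. *)
have Vk V : 0 < V -> m x0 (A * r) <= C2 * V -> V^-1 <= C2 * c0 * k.
  move=> V0 hV; apply: (@le_trans _ _ (C2 / m x0 (A * r))).
    by rewrite ler_pdivlMr// mulrC ler_pdivrMr.
  rewrite -mulrA ler_pM2l// -ler_pdivrMl//.
  by apply: le_trans Kge; rewrite invfM.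
have om t : 0 <= t -> t <= 2 * A0 / A -> omega t <= eps / (2 * C2 * c0).
  move=> t0' tA; apply: ht0; rewrite ?t0' /=.
    by apply: le_trans tA _; rewrite ler_pdivrMr// (mulrC t0) -ler_pdivrMr.
  by apply: le_trans tA _; rewrite ler_pdivrMr// mul1r; nra.
have half V t : 0 < V -> m x0 (A * r) <= C2 * V -> 0 <= t -> t <= 2 * A0 / A ->
    V^-1 * omega t <= eps / 2 * k.
  move=> V0 hV t_ge0 tA.
  apply: (@le_trans _ _ (V^-1 * (eps / (2 * C2 * c0)))).
    by rewrite ler_pM2l ?invr_gt0// om.
  apply: (@le_trans _ _ (C2 * c0 * k * (eps / (2 * C2 * c0)))).
    by rewrite ler_pM2r ?Vk// divr_gt0// !mulr_gt0.
  by rewrite le_eqVlt; apply/orP; left; apply/eqP; field; rewrite !gt_eqF.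
have R1 : rho x0 x < (2 * A0)^-1 * rho x0 y.
  rewrite mulrC ltr_pdivlMr//; apply: lt_le_trans hy.
  rewrite ltr_pdivlMr//; apply: (@lt_le_trans _ _ (r * (2 * A0) * (2 * A0))).
    by rewrite ltr_pM2r// ltr_pM2r.
  apply: (@le_trans _ _ (5 * A0 ^+ 2 * r)); last by rewrite ler_pM2r.
  have : 0 <= A0 ^+ 2 * r by rewrite mulr_ge0 ?sqr_ge0 ?ltW.
  by lra.
have R2 : rho y0 y < (2 * A0)^-1 * rho y0 x0.
  rewrite mulrC ltr_pdivlMr// (qmetric_sym hrho y0 x0); apply: lt_le_trans A5r.
  apply: (@lt_le_trans _ _ (r * (2 * A0))); first by rewrite ltr_pM2r.
  rewrite mulrC ler_pM2r// expr2; have : A0 <= A0 * A0 by rewrite ler_pMl.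
  by lra.
(* The pair [(x, y)] is moved to [(x0, y0)] one coordinate at a time, through [(x0, y)]. *)
have E1 : cabs (K x y - K x0 y) <= eps / 2 * k.
  rewrite cabsB; apply: le_trans (half (Vball rho mu x0 y) (rho x0 x / rho x0 y) V10 V1 _ _).
  - by apply: le_trans (CZ_kernel_regularity hK R1); rewrite lerDl cabs_ge0.
  - by rewrite divr_ge0 ?(qmetric_ge0 hrho).
  - rewrite ler_pdivrMr//; apply: le_trans (ltW x0x) _.
    have -> : r = 2 * A0 / A * (A * r / (2 * A0)) by field; rewrite !gt_eqF.
    by rewrite ler_pM2l// divr_gt0.
have E2 : cabs (K x0 y - K x0 y0) <= eps / 2 * k.
  rewrite cabsB; apply: le_trans (half (Vball rho mu y0 x0) (rho y0 y / rho y0 x0) V20 V2 _ _).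
  - by apply: le_trans (CZ_kernel_regularity hK R2); rewrite lerDr cabs_ge0.
  - by rewrite divr_ge0 ?(qmetric_ge0 hrho).
  - rewrite (qmetric_sym hrho y0 x0) ler_pdivrMr//; apply: le_trans (ltW y0y) _.
    have -> : r = A^-1 * (A * r) by rewrite mulKf// gt_eqF.
    apply: ler_pM => //; rewrite ?invr_ge0 ?ltW//.
    by rewrite ltr_pMl ?invr_gt0//; lra.
apply: le_trans (cabs_triangle _ _ (K x0 y)) _.
by have := lerD E1 E2; rewrite -/k; lra.
Qed.

End kernels.

(** * The weak type extension off the support *)

Section weak_type_extension.
Context (R : realType) d (X : measurableType d).
Variable mu : {measure set X -> \bar R}.

(** Meant for sets not known to be measurable, such as the set where an integral formula fails: the
    integral is not known to be measurable in [x]. *)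
Lemma negligible_small_cover (S : set X) :
  (forall e : R, 0 < e ->
    exists Z, [/\ measurable Z, S `<=` Z & (mu Z <= e%:E)%E]) ->
  mu.-negligible S.
Proof.
move=> h.
have /choice[Z hZ] : forall n : nat,
    exists Z, [/\ measurable Z, S `<=` Z & (mu Z <= (n.+1%:R^-1)%:E)%E].
  by move=> n; apply: h; rewrite invr_gt0.
exists (\bigcap_n Z n); split.
- by apply: bigcapT_measurable => n; have [] := hZ n.
- apply/eqP; rewrite eq_le measure_ge0 andbT.
  apply/lee_addgt0Pr => e e0; rewrite add0e.
  have [n ne] : exists n : nat, n.+1%:R^-1 < e.
    exists (Num.bound e^-1); rewrite invf_plt ?posrE//.
    apply: lt_trans (_ : _ < (Num.bound e^-1)%:R) _.
      by apply: archi_boundP; rewrite invr_ge0 ltW.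
    by rewrite ltr_nat.
  apply: (@le_trans _ _ (mu (Z n))).
    apply: le_measure; rewrite ?inE.
    + by apply: bigcapT_measurable => k; have [] := hZ k.
    + by have [] := hZ n.
    + exact: bigcap_inf.
  by have [_ _ /le_trans] := hZ n; apply; rewrite lee_fin ltW.
- by move=> x Sx n _; have [_ + _] := hZ n; exact.
Qed.

Lemma integral_zero_outside (E : set X) (f : X -> \bar R) :
  (forall x, ~ E x -> f x = 0%E) ->
  (\int[mu]_x f x = \int[mu]_(x in E) f x)%E.
Proof.
move=> f0; rewrite [RHS]integral_mkcond; apply: eq_integral => x _.
by rewrite patchE; case: ifPn => //; rewrite notin_setE => /f0.
Qed.

Lemma Lp_norm1E (E : set X) (f : X -> R[i]) : (forall x, ~ E x -> f x = 0) ->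
  Lp_norm mu 1 (fun=> 1) f = (\int[mu]_(x in E) (cabs (f x))%:E)%E.
Proof.
move=> f0; rewrite /Lp_norm Lnorm1.
under eq_integral do rewrite mulr1 abse_EFin ger0_norm ?cabs_ge0//.
by apply: integral_zero_outside => x /f0 ->; rewrite cabs0.
Qed.

Lemma in_L1_zero_outside (E : set X) (f : X -> R[i]) : measurable E ->
  cmeasurable f -> (forall x, ~ E x -> f x = 0) -> cintegrable mu E f ->
  in_Lp mu 1 f.
Proof. by move=> mE mf f0 fi; split => //; rewrite (Lp_norm1E f0); case: fi. Qed.

Lemma in_Lp_bounded (p : R) (E : set X) (f : X -> R[i]) (M : R) : 0 < p ->
  measurable E -> (mu E < +oo)%E -> cmeasurable f ->
  (forall x, ~ E x -> f x = 0) -> (forall x, cabs (f x) <= M) ->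
  in_Lp mu p f.
Proof.
move=> p0 mE Eoo mf f0 fM; split => //.
rewrite /Lp_norm unlock poweR_lty//.
rewrite (@integral_zero_outside E); last first.
  by move=> x /f0 ->; rewrite cabs0 mul0r abse0 poweR0r// gt_eqF.
apply: (@le_lt_trans _ _ (\int[mu]_(x in E) (cst (M `^ p)%:E x)%E)%E); last first.
  by rewrite integral_cst// lte_mul_pinfty// lee_fin powR_ge0.
apply: ge0_le_integral => //.
- by move=> x _; exact: poweR_ge0.
- apply: (measurable_funS measurableT) => //.
  have mc : measurable_fun setT (fun x => cabs (f x) * 1).
    by under eq_fun do rewrite mulr1; exact: measurable_cabs.
  have -> : (fun x => (`|(cabs (f x) * 1)%:E| `^ p)%E) =
      EFin \o (fun x => (cabs (f x) * 1) `^ p).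
    by apply/funext => x /=; rewrite mulr1 ger0_norm ?cabs_ge0.
  apply/measurable_EFinP.
  by apply: (measurableT_comp (measurable_powR p)).
- move=> x _; rewrite mulr1 abse_EFin (ger0_norm (cabs_ge0 _)) /= lee_fin.
  apply: ge0_ler_powR; rewrite ?nnegrE; [exact: ltW|exact: cabs_ge0| |exact: fM].
  exact: le_trans (cabs_ge0 (f x)) (fM x).
Qed.

(** Large values are replaced by [0], so that a truncation vanishing off a set of finite measure
    lies in L^2, where the kernel formula is given. *)
Definition ctruncation (n : nat) (g : X -> R[i]) : X -> R[i] :=
  fun x => Complex (\1_[set y | cabs (g y) <= n%:R] x) 0 * g x.

Lemma ctruncation_measurable n g : cmeasurable g ->
  cmeasurable (ctruncation n g).
Proof.
move=> mg; apply: cmeasurable_onM => //.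
apply: cmeasurable_on_real; apply: measurable_indic.
rewrite (_ : [set y | _] = setT `&` (fun y => cabs (g y)) @^-1` `]-oo, n%:R]).
  by apply: measurable_cabs.
by apply/seteqP; split => y /=; rewrite in_itv /=; tauto.
Qed.

Lemma ctruncation_le n g x : cabs (ctruncation n g x) <= n%:R.
Proof.
rewrite /ctruncation cabsM cabs_real indicE; have [|_] := boolP (x \in _).
  by rewrite inE /= normr1 mul1r.
by rewrite normr0 mul0r.
Qed.

Lemma cabs_sub_ctruncation_le n g x :
  cabs (g x - ctruncation n g x) <= cabs (g x).
Proof.
rewrite /ctruncation indicE; have [_|_] := boolP (x \in _).
  by rewrite -[Complex _ _]/(1 : R[i]) mul1r subrr cabs0 cabs_ge0.
by rewrite -[Complex _ _]/(0 : R[i]) mul0r subr0.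
Qed.

(** Dominated convergence with majorant [cabs (g x)]: at each point the difference is eventually
    [0]. *)
Lemma ctruncation_cvg (E : set X) g : measurable E -> cmeasurable g ->
  cintegrable mu E g -> forall e : R, 0 < e ->
  exists n, \int[mu]_(x in E) cabs (g x - ctruncation n g x) <= e.
Proof.
move=> mE mg gi e e0.
pose F n x := (cabs (g x - ctruncation n g x))%:E.
have mF n : measurable_fun E (F n).
  apply/measurable_EFinP/measurable_cabs/cmeasurable_onB.
    exact: cmeasurable_onW.
  by apply: cmeasurable_onW => //; exact: ctruncation_measurable.
have F0 x : E x -> F ^~ x @ \oo --> 0%E.
  move=> _; apply: cvg_near_cst; exists (Num.bound (cabs (g x))) => // n /= gn.
  rewrite /F /ctruncation indicE mem_set/=.
    by rewrite -[Complex _ _]/(1 : R[i]) mul1r subrr cabs0.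
  apply: le_trans (_ : (Num.bound (cabs (g x)))%:R <= _); last by rewrite ler_nat.
  exact/ltW/archi_boundP/cabs_ge0.
have Fg x n : E x -> (`|F n x| <= (cabs (g x))%:E)%E.
  move=> _; rewrite /F abse_EFin ger0_norm ?cabs_ge0// lee_fin.
  exact: cabs_sub_ctruncation_le.
have [_ _] := @dominated_convergence _ _ _ mu E mE F (cst 0%E)
  (fun x => (cabs (g x))%:E) mF (measurable_cst _) (aeW _ F0)
  (cintegrable_cabs gi) (aeW _ Fg).
rewrite integral0 => /fine_cvgP[_].
move=> /cvgrPdist_le /(_ e e0)[n _ /(_ n (leqnn n))]; rewrite /= sub0r normrN.
by move=> h; exists n; apply: le_trans (ler_norm _) h.
Qed.

(** Write [g = h + gn] with [gn] a truncation. For [gn] the formula is that of [T]. The kernel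
    integral of [h] is uniformly small on [B], as [K] is bounded on [B] times [E], and [T1 h] is
    small off a set of small measure by the weak type bound. Hence the two sides differ by more than
    [t] only on a null set. *)
Lemma weak_L1_formula (rho : X -> X -> R) (K : X -> X -> R[i])
    (T T1 : (X -> R[i]) -> (X -> R[i])) (B E : set X) (g : X -> R[i]) (M : R) :
  weak_L1_extension mu T T1 ->
  (forall f, in_Lp mu 2 f -> {ae mu, forall x, ~ qsupport rho f x ->
    T f x = cintegral mu setT (fun y => K x y * f y)}) ->
  measurable E -> (mu E < +oo)%E ->
  cmeasurable g -> (forall x, ~ E x -> g x = 0) -> cintegrable mu E g ->
  (forall x, B x -> ~ qclosure rho E x) ->
  (forall x, B x -> cmeasurable_on E (K x)) ->
  (forall x y, B x -> E y -> cabs (K x y) <= M) ->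
  {ae mu, forall x, B x ->
    T1 g x = cintegral mu E (fun y => K x y * g y)}.
Proof.
move=> hT1 hT mE Eoo mg g0 gi BE mK KM.
pose G x := cintegral mu E (fun y => K x y * g y).
pose M1 := `|M|.
have KM1 x y : B x -> E y -> cabs (K x y) <= M1.
  by move=> Bx Ey; apply: le_trans (KM x y Bx Ey) _; exact: ler_norm.
pose S (t : R) := [set x | B x /\ t < cabs (T1 g x - G x)].
suff negS (t : R) : 0 < t -> mu.-negligible (S t).
  apply: (@negligibleS _ _ _ mu (\bigcup_n S n.+1%:R^-1)); last first.
    by apply: negligible_bigcup => n; apply: negS; rewrite invr_gt0.
  move=> x /= /not_implyP[Bx /eqP neq].
  have c0 : 0 < cabs (T1 g x - G x).
    rewrite lt_neqAle cabs_ge0 andbT eq_sym; apply: contra neq => /eqP/cabs_eq0.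
    by move/eqP; rewrite subr_eq0.
  exists (Num.bound (cabs (T1 g x - G x))^-1) => //; split => //.
  rewrite invf_plt ?posrE//.
  apply: lt_trans (_ : _ < (Num.bound (cabs (T1 g x - G x))^-1)%:R) _.
    by apply: archi_boundP; rewrite invr_ge0 ltW.
  by rewrite ltr_nat.
move=> t0; have [C hC] := weak_L1_bounded hT1.
pose C1 := `|C|.
apply: negligible_small_cover => e e0.
(* The first bound keeps the kernel integral of [h] below [t / 2], the second keeps the measure of
   [Z] below [e]; adding 1 avoids a zero denominator. *)
pose eta := Num.min (t / (4 * (M1 + 1))) (e * t / (2 * (C1 + 1))).
have M10 : 0 <= M1 by exact: normr_ge0.
have C10 : 0 <= C1 by exact: normr_ge0.
have eta0 : 0 < eta.
  by rewrite lt_min !divr_gt0 ?mulr_gt0//; lra.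
have [n hn] := ctruncation_cvg mE mg gi eta0.
set gn := ctruncation n g in hn.
set delta := (X in X <= eta) in hn.
have delta0 : 0 <= delta by apply: Rintegral_ge0 => x _; exact: cabs_ge0.
have mgn : cmeasurable gn by exact: ctruncation_measurable.
have gn0 x : ~ E x -> gn x = 0 by move=> /g0 gx; rewrite /gn /ctruncation gx mulr0.
have gni : cintegrable mu E gn.
  apply: (@cintegrable_bounded _ _ _ _ _ _ n%:R) => //.
    exact: cmeasurable_onW.
  by move=> x _; exact: ctruncation_le.
have gn1 := in_L1_zero_outside mE mgn gn0 gni.
have gn2 : in_Lp mu 2 gn.
  by apply: (@in_Lp_bounded _ E _ n%:R) => // x; exact: ctruncation_le.
pose h x := g x - gn x.
have mh : cmeasurable h by exact: cmeasurable_onB.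
have h0 x : ~ E x -> h x = 0 by move=> Ex; rewrite /h g0// gn0// subrr.
have hi : cintegrable mu E h by exact: cintegrableB.
have h1 := in_L1_zero_outside mE mh h0 hi.
have normh : (Lp_norm mu 1 (fun=> 1%R) h = delta%:E)%E.
  rewrite (Lp_norm1E h0) /delta /Rintegral fineK//.
  rewrite ge0_fin_numE; first by case: hi.
  by apply: integral_ge0 => x _; rewrite lee_fin cabs_ge0.
have [N1 [mN1 N10 sN1]] := weak_L1_linear hT1 1 h1 gn1.
have [N2 [mN2 N20 sN2]] := weak_L1_extends hT1 gn1 gn2.
have [N3 [mN3 N30 sN3]] := hT _ gn2.
pose Z := [set x | t / 2 < cabs (T1 h x)].
have mZ : measurable Z.
  rewrite (_ : Z = setT `&` (fun y => cabs (T1 h y)) @^-1` `]t / 2, +oo[).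
    by apply: measurable_cabs => //; exact: (weak_L1_measurable hT1 h1).
  by apply/seteqP; split => y /=; rewrite /Z /= in_itv /= andbT; tauto.
have muZ : (mu Z <= e%:E)%E.
  have t20 : 0 < t / 2 by rewrite divr_gt0.
  have := hC h h1 _ t20; rewrite normh -EFinM -/Z => hZ.
  rewrite -(@lee_pmul2l _ (t / 2)%:E)//.
  apply: le_trans hZ _; rewrite -EFinM lee_fin.
  apply: (@le_trans _ _ ((C1 + 1) * eta)).
    apply: (@le_trans _ _ (C1 * delta)).
      by apply: ler_wpM2r => //; exact: ler_norm.
    by apply: ler_pM => //; lra.
  apply: (@le_trans _ _ ((C1 + 1) * (e * t / (2 * (C1 + 1))))).
    by apply: ler_wpM2l; [lra|rewrite ge_min lexx orbT].
  rewrite le_eqVlt; apply/orP; left; apply/eqP; field.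
  by rewrite gt_eqF//; lra.
have iK f : cintegrable mu E f -> forall x, B x ->
    cintegrable mu E (fun y => K x y * f y).
  move=> fi x Bx; apply: (@cintegrableMl _ _ _ _ _ _ _ M1) => //.
    exact: mK.
  by move=> y Ey; exact: KM1.
(* At a point of [B] outside the three null sets the identities hold, and outside [Z] the value
   [T1 h x] is at most [t / 2]; a point of [S t] outside all four would give [t < t / 2 + t / 2]. *)
exists (N1 `|` N2 `|` N3 `|` Z); split.
- by do 3 (apply: measurableU => //).
- move=> x [Bx tx].
  apply: contrapT => /not_orP[/not_orP[/not_orP[nN1 nN2] nN3] nZ].
  have e1 : T1 g x = T1 h x + T1 gn x.
    have -> : g = (fun y => 1 * h y + gn y).
      by apply/funext => y; rewrite mul1r subrK.
    rewrite -[T1 h x]mul1r.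
    by apply: contrapT => nP; apply: nN1; exact: sN1.
  have e2 : T1 gn x = T gn x.
    by apply: contrapT => nP; apply: nN2; exact: sN2.
  have e3 : T gn x = cintegral mu E (fun y => K x y * gn y).
    rewrite -(@cintegralT _ _ _ mu E)//; last by move=> y /gn0 ->; rewrite mulr0.
    apply: contrapT => nP; apply: nN3; apply: sN3 => /= nP'; apply: nP; apply: nP'.
    move=> xs; apply: (BE x Bx) => U oU Ux.
    have [y [Uy /= gy]] := xs U oU Ux; exists y; split => //.
    by apply: contrapT => /gn0 gy0; rewrite gy0 eqxx in gy.
  have e4 : G x = cintegral mu E (fun y => K x y * h y)
      + cintegral mu E (fun y => K x y * gn y).
    rewrite -cintegralD//; [|exact: iK|exact: iK].
    by apply: eq_cintegral => y _; rewrite -mulrDr subrK.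
  have e5 : cabs (cintegral mu E (fun y => K x y * h y)) <= 2 * (M1 * delta).
    apply: le_trans (cabs_cintegral mE (iK _ hi x Bx)) _.
    rewrite ler_pM2l// /delta -RintegralZl//; last exact: cintegrable_cabs.
    apply: le_Rintegral => //.
    - exact: cintegrable_cabs (iK _ hi x Bx).
    - exact: integrableZl (cintegrable_cabs hi).
    - move=> y Ey; rewrite cabsM; apply: ler_wpM2r; first exact: cabs_ge0.
      exact: KM1.
  have e6 : 2 * (M1 * delta) <= t / 2.
    apply: (@le_trans _ _ (2 * ((M1 + 1) * (t / (4 * (M1 + 1)))))).
      rewrite ler_pM2l//; apply: ler_pM => //; first lra.
      by apply: le_trans hn _; rewrite ge_min lexx.
    rewrite le_eqVlt; apply/orP; left; apply/eqP; field.
    by rewrite gt_eqF//; lra.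
  have : t < cabs (T1 h x) + t / 2.
    apply: lt_le_trans tx _; rewrite e1 e2 e3 e4 opprD addrACA subrr addr0.
    apply: le_trans (cabsD _ _) _; rewrite lerD2l cabsN.
    exact: le_trans e5 e6.
  by move=> h'; apply: nZ; rewrite /Z /=; lra.
- have mN : measurable (N1 `|` N2 `|` N3) by do 2 apply: measurableU => //.
  have N0 : mu (N1 `|` N2 `|` N3) = 0%E.
    apply: null_set_setU => //; first exact: measurableU.
    exact: null_set_setU.
  by apply: le_trans (measureU2 mu mN mZ) _; rewrite -[leRHS]add0e leeD// le_eqVlt; apply/orP; left; apply/eqP.
Qed.

End weak_type_extension.

(** * Lower bound for the commutator *)

Definition creal (R : realType) (X : Type) (s : X -> R) : X -> R[i] :=
  fun y => Complex (s y) 0.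

Section commutator_lower_bound.
Context (R : realType) d (X : measurableType d) (rho : X -> X -> R)
  (mu : {measure set X -> \bar R}) (K : X -> X -> R[i])
  (T T1 : (X -> R[i]) -> (X -> R[i])) (B E : set X) (b : X -> R[i])
  (k : R[i]) (eps : R).
Hypothesis hT : forall f, in_Lp mu 2 f -> {ae mu, forall x, ~ qsupport rho f x ->
  T f x = cintegral mu setT (fun y => K x y * f y)}.
Hypothesis hTm : forall f, in_Lp mu 2 f -> cmeasurable (T f).
Hypothesis hT1 : weak_L1_extension mu T T1.
Hypotheses (mB : measurable B) (mE : measurable E).
Hypotheses (Boo : (mu B < +oo)%E) (Eoo : (mu E < +oo)%E).
Hypotheses (mb : cmeasurable b) (bB : cintegrable mu B b)
  (bE : cintegrable mu E b).
Hypothesis BE : forall x, B x -> ~ qclosure rho E x.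
Hypothesis mK : forall x, B x -> cmeasurable_on E (K x).
Hypothesis Kk : forall x y, B x -> E y -> cabs (K x y - k) <= eps * cabs k.

(** A single class for the indicator of [E] and the two sign functions, on which one bound [tau]
    holds uniformly. *)
Definition test_function (s : X -> R) : Prop :=
  [/\ measurable_fun setT s, forall y, `|s y| <= 1 & forall y, ~ E y -> s y = 0].

Local Notation bc c := (fun y => b y - c).

Let KM x y : B x -> E y -> cabs (K x y) <= eps * cabs k + cabs k.
Proof.
move=> Bx Ey; rewrite -[K x y](subrK k); apply: le_trans (cabsD _ _) _.
by rewrite lerD2r; exact: Kk.
Qed.

Section fixed_test_function.
Variables (s : X -> R) (hs : test_function s).

Let ms : cmeasurable (creal s).
Proof. by apply: cmeasurable_on_real; case: hs. Qed.

Let s1 y : cabs (creal s y) <= 1.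
Proof. by rewrite /creal cabs_real; case: hs. Qed.

Let s0 y : ~ E y -> creal s y = 0 :> R[i].
Proof. by case: hs => _ _ h /h sy; rewrite /creal sy. Qed.

Lemma test_function_L2 : in_Lp mu 2 (creal s).
Proof. exact: (@in_Lp_bounded _ _ _ _ _ E _ 1). Qed.

Let msE : cmeasurable_on E (creal s).
Proof. exact: cmeasurable_onW. Qed.

Let is_ : cintegrable mu E (creal s).
Proof. exact: (@cintegrable_bounded _ _ _ _ _ _ 1). Qed.

Let intM f : cintegrable mu E f -> cintegrable mu E (fun y => f y * creal s y).
Proof.
move=> fi; have := @cintegrableMl _ _ _ mu E (creal s) f 1 mE msE.
by move=> /(_ (fun y _ => s1 y) fi); under eq_fun do rewrite mulrC.
Qed.

Let mbs : cmeasurable (fun y => b y * creal s y).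
Proof. exact: cmeasurable_onM. Qed.

Let bs0 y : ~ E y -> b y * creal s y = 0.
Proof. by move=> Ey; rewrite s0// mulr0. Qed.

Let bs_L1 : in_Lp mu 1 (fun y => b y * creal s y).
Proof.
by apply: (in_L1_zero_outside mE) => //; exact: intM.
Qed.

Lemma commutator_measurable : cmeasurable (commutator T T1 b (creal s)).
Proof.
apply: cmeasurable_onB; last exact: (weak_L1_measurable hT1).
by apply: cmeasurable_onM => //; apply: hTm; exact: test_function_L2.
Qed.

Lemma commutator_formula : {ae mu, forall x, B x ->
  commutator T T1 b (creal s) x = b x * cintegral mu E (fun y => K x y * creal s y)
    - cintegral mu E (fun y => K x y * (b y * creal s y))}.
Proof.
have h1 := weak_L1_formula hT1 hT mE Eoo mbs bs0 (intM bE) BE mK KM.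
have h2 := hT test_function_L2.
apply: filterS2 h1 h2.
move=> x e1 e2 Bx; rewrite /commutator e1// e2; last first.
  move=> xs; apply: (BE Bx) => U oU Ux; have [y [Uy /= sy]] := xs U oU Ux.
  by exists y; split => //; apply: contrapT => /s0 sy0; rewrite sy0 eqxx in sy.
by rewrite (@cintegralT _ _ _ mu E)// => y Ey; rewrite s0// mulr0.
Qed.

(* Replacing [K x y] by [k] turns the commutator into
   [k (b x \int s - \int b s)]. *)
Lemma commutator_pointwise (c : R[i]) : {ae mu, forall x, B x ->
  cabs k * cabs (b x * cintegral mu E (creal s)
      - cintegral mu E (fun y => b y * creal s y)) <=
  cabs (commutator T T1 b (creal s) x) + 2 * eps * cabs k *
    (fine (mu E) * cabs (b x - c) + \int[mu]_(y in E) cabs (b y - c))}.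
Proof.
apply: filterS commutator_formula => x hx Bx.
pose e y := K x y - k.
have me : cmeasurable_on E e.
  by apply: cmeasurable_onB; [exact: mK|exact: cmeasurable_on_cst].
have ke y : E y -> cabs (e y) <= eps * cabs k by exact: Kk.
have ie f : cintegrable mu E f -> cintegrable mu E (fun y => e y * f y).
  by move=> fi; exact: (cintegrableMl mE me ke fi).
have ik z f : cintegrable mu E f -> cintegrable mu E (fun y => z * f y).
  move=> fi; apply: (@cintegrableMl _ _ _ _ _ (fun=> z) _ (cabs z)) => //.
have split_K f : cintegrable mu E f ->
    cintegral mu E (fun y => K x y * f y) =
    k * cintegral mu E f + cintegral mu E (fun y => e y * f y).
  move=> fi; rewrite -cintegralZl// -cintegralD//; [|exact: ik|exact: ie].
  by apply: eq_cintegral => y _; rewrite -mulrDl addrC subrK.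
have ibs := intM bE.
pose w y := b x * creal s y - b y * creal s y.
have iw : cintegrable mu E w.
  by apply: cintegrableB => //; exact: ik.
(* The two errors merge into one integral of [(K x y - k) * (b x - b y) * s y]. Only differences of
   [b] occur, so any constant [c] can be inserted between [b x] and [b y]. *)
have ce : b x * cintegral mu E (fun y => e y * creal s y)
    - cintegral mu E (fun y => e y * (b y * creal s y)) =
    cintegral mu E (fun y => e y * w y).
  rewrite -cintegralZl//; last exact: ie.
  rewrite -cintegralB//; [|by apply: ik; exact: ie|exact: ie].
  by apply: eq_cintegral => y _; rewrite /w mulrBr mulrCA.
have comE : commutator T T1 b (creal s) x =
    k * (b x * cintegral mu E (creal s) - cintegral mu E (fun y => b y * creal s y))
    + cintegral mu E (fun y => e y * w y).
  by rewrite hx// !split_K// -ce; ring.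
have ibc : cintegrable mu E (bc c).
  by apply: cintegrableB => //; apply: (@cintegrable_bounded _ _ _ _ _ _ (cabs c))
    => //; exact: cmeasurable_on_cst.
have bd : cabs (cintegral mu E (fun y => e y * w y)) <= 2 * (eps * cabs k *
    (fine (mu E) * cabs (b x - c) + \int[mu]_(y in E) cabs (b y - c))).
  apply: le_trans (cabs_cintegral mE (ie _ iw)) _.
  rewrite ler_pM2l//.
  have icst (r : R) : mu.-integrable E (EFin \o (fun=> r)).
    apply/integrableP; split; first exact: measurable_cst.
    by rewrite /= integral_cst// lte_mul_pinfty.
  rewrite (mulrC (fine _)) -Rintegral_cst// -RintegralD//; [|exact: cintegrable_cabs].
  have isum : mu.-integrable E
      (EFin \o (fun y => cabs (b x - c) + cabs (b y - c))).
    exact: integrableD (icst _) (cintegrable_cabs ibc).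
  rewrite -RintegralZl//; apply: le_Rintegral => //.
  - exact: cintegrable_cabs (ie _ iw).
  - by have := integrableZl mE (eps * cabs k) isum.
  move=> y Ey; rewrite cabsM; apply: ler_pM; [exact: cabs_ge0|exact: cabs_ge0| |].
    exact: ke.
  rewrite /w -mulrBl cabsM; apply: (@le_trans _ _ (cabs (b x - b y))).
    by rewrite ler_piMr ?cabs_ge0.
  apply: le_trans (cabs_triangle _ _ c) _.
  by rewrite lerD2l cabsB.
rewrite -cabsM.
have -> : k * (b x * cintegral mu E (creal s) - cintegral mu E (fun y => b y * creal s y))
   = commutator T T1 b (creal s) x - cintegral mu E (fun y => e y * w y).
  by rewrite comE addrK.
apply: le_trans (cabsD _ _) _; rewrite cabsN lerD2l.
by apply: le_trans bd _; rewrite !mulrA.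
Qed.

(** The pointwise estimate is integrated in [x] over [B]; the integrals over [E] enter as constants,
    which turns the error into a multiple of the symmetric sum of the two oscillations. *)
Lemma commutator_integrated (c : R[i]) (tau : R) : 0 <= eps ->
  (\int[mu]_(x in B) (cabs (commutator T T1 b (creal s) x))%:E <= tau%:E)%E ->
  cabs k * \int[mu]_(x in B) cabs (b x * cintegral mu E (creal s)
      - cintegral mu E (fun y => b y * creal s y)) <=
  tau + 2 * eps * cabs k *
    (fine (mu E) * \int[mu]_(x in B) cabs (b x - c)
     + fine (mu B) * \int[mu]_(y in E) cabs (b y - c)).
Proof.
move=> eps0 htau.
set F := cintegral mu E (creal s); set G := cintegral mu E _.
have icst z : cintegrable mu B (fun=> z).
  apply: (@cintegrable_bounded _ _ _ _ _ _ (cabs z)) => //.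
have ibF : cintegrable mu B (fun x => b x * F - G).
  apply: cintegrableB => //.
  have := @cintegrableMl _ _ _ mu B (fun=> F) b (cabs F) mB
    (cmeasurable_on_cst _ _) (fun _ _ => lexx _) bB.
  by under eq_fun do rewrite mulrC.
have ibc : cintegrable mu B (bc c) by exact: cintegrableB.
set Eo := \int[mu]_(y in E) cabs (b y - c).
have Eo0 : 0 <= Eo by apply: Rintegral_ge0 => y _; exact: cabs_ge0.
pose h x := 2 * eps * cabs k * (fine (mu E) * cabs (b x - c) + Eo).
have icR (r : R) : mu.-integrable B (EFin \o (fun=> r)).
  apply/integrableP; split; first exact: measurable_cst.
  by rewrite /= integral_cst// lte_mul_pinfty.
have ih0 : mu.-integrable B (EFin \o (fun x => fine (mu E) * cabs (b x - c) + Eo)).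
  have := integrableZl mB (fine (mu E)) (cintegrable_cabs ibc) => i1.
  exact: (integrableD mB i1 (icR Eo)).
have ih : mu.-integrable B (EFin \o h).
  by have := integrableZl mB (2 * eps * cabs k) ih0.
have h0 x : 0 <= h x.
  apply: mulr_ge0; first by apply: mulr_ge0; [exact: mulr_ge0|exact: cabs_ge0].
  by apply: addr_ge0 => //; apply: mulr_ge0; [exact: fine_ge0|exact: cabs_ge0].
have hint : \int[mu]_(x in B) h x = 2 * eps * cabs k *
    (fine (mu E) * \int[mu]_(x in B) cabs (b x - c) + fine (mu B) * Eo).
  rewrite RintegralZl// RintegralD//; last first.
    by have := integrableZl mB (fine (mu E)) (cintegrable_cabs ibc).
  rewrite RintegralZl//; last exact: cintegrable_cabs ibc.
  by rewrite Rintegral_cst// (mulrC Eo).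
rewrite -hint -RintegralZl//; last exact: cintegrable_cabs ibF.
have ikF : mu.-integrable B (EFin \o (fun x => cabs k * cabs (b x * F - G))).
  by have := integrableZl mB (cabs k) (cintegrable_cabs ibF).
have mcom : measurable_fun B (fun x => cabs (commutator T T1 b (creal s) x)).
  by apply: measurable_cabs; apply: cmeasurable_onW => //; exact: commutator_measurable.
(* The comparison is made between extended integrals of nonnegative functions, so the commutator
   needs measurability but no separate proof of integrability. *)
rewrite -lee_fin EFinD /Rintegral !fineK; last 2 first.
- exact: integrable_fin_num ih.
- exact: integrable_fin_num ikF.
apply: (@le_trans _ _ (\int[mu]_(x in B)
    ((cabs (commutator T T1 b (creal s) x))%:E + (h x)%:E))%E).
  apply: ae_ge0_le_integral => //.
  - by move=> x _; rewrite lee_fin mulr_ge0 ?cabs_ge0.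
  - exact: (measurable_int mu ikF).
  - by move=> x _; rewrite adde_ge0// lee_fin ?cabs_ge0.
  - apply: emeasurable_funD; first exact/measurable_EFinP.
    exact: (measurable_int mu ih).
  - apply: filterS (commutator_pointwise c) => x hx Bx.
    by rewrite -EFinD lee_fin; exact: hx.
rewrite ge0_integralD//.
- by rewrite leeD2r.
- by move=> x _; rewrite lee_fin cabs_ge0.
- exact/measurable_EFinP.
- by move=> x _; rewrite lee_fin.
- exact: (measurable_int mu ih).
Qed.

End fixed_test_function.

Lemma Re_cintegral D f :
  complex.Re (cintegral mu D f) = \int[mu]_(x in D) complex.Re (f x).
Proof. by []. Qed.

Lemma Im_cintegral D f :
  complex.Im (cintegral mu D f) = \int[mu]_(x in D) complex.Im (f x).
Proof. by []. Qed.

Lemma caverageK D f : 0 < fine (mu D) ->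
  Complex (fine (mu D)) 0 * caverage mu D f = cintegral mu D f.
Proof.
move=> D0; have mV : Complex (fine (mu D)) 0 * Complex (fine (mu D))^-1 0 = 1.
  by apply: complexP; rewrite !ReImE /= ?mulr0 ?mul0r ?addr0 ?subr0// mulfV// gt_eqF.
by rewrite /caverage mulrA mV mul1r.
Qed.

(* The test functions [1_E], [1_E sgn (Re (b - c))], [1_E sgn (Im (b - c))] recover
   the oscillations of [b] on [B] and [E] up to an error controlled by the same
   oscillations, which is absorbed since [eps = 1/20]. *)
Lemma commutator_oscillation (tau : R) : eps = 20^-1 -> 0 < fine (mu E) ->
  0 < fine (mu B) ->
  (forall s, test_function s ->
    \int[mu]_(x in B) (cabs (commutator T T1 b (creal s) x))%:E <= tau%:E)%E ->
  cabs k * fine (mu E) * \int[mu]_(x in B) cabs (b x - caverage mu B b)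
    <= 30 * tau.
Proof.
move=> eps20 E0 B0 htau.
have eps0 : 0 <= eps by rewrite eps20 invr_ge0.
pose c := caverage mu E b.
have icst D (c' : R[i]) : measurable D -> (mu D < +oo)%E ->
    cintegrable mu D (fun=> c').
  move=> mD Doo; apply: (@cintegrable_bounded _ _ _ _ _ _ (cabs c')) => //.
have ibcB : cintegrable mu B (bc c) by apply: cintegrableB => //; exact: icst.
have ibcE : cintegrable mu E (bc c) by apply: cintegrableB => //; exact: icst.
set A := \int[mu]_(x in B) cabs (b x - c).
set Eo := \int[mu]_(x in E) cabs (b x - c).
set mE' := fine (mu E); set mB' := fine (mu B).
set kap := cabs k.
have kap0 : 0 <= kap by exact: cabs_ge0.
set D := mE' * A + mB' * Eo.
have A0 : 0 <= A by apply: Rintegral_ge0 => x _; exact: cabs_ge0.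
have Eo0 : 0 <= Eo by apply: Rintegral_ge0 => x _; exact: cabs_ge0.
have hs s : test_function s -> kap * \int[mu]_(x in B) cabs (b x *
    cintegral mu E (creal s) - cintegral mu E (fun y => b y * creal s y)) <=
    tau + 2 * eps * kap * D.
  by move=> hs; exact: (commutator_integrated hs c eps0 (htau s hs)).
have t1 : test_function (\1_E : X -> R).
  split; first exact: measurable_indic.
  - by move=> y; rewrite indicE; case: (y \in E); rewrite ?normr1 ?normr0.
  - by move=> y Ey; rewrite indicE memNset.
have cE : cintegral mu E b = Complex mE' 0 * c.
  by rewrite /c caverageK.
(* As [c] is the mean on [E], the indicator of [E] turns the main term into exactly
   [mE' * (b x - c)]. *)
have s1 : kap * (mE' * A) <= tau + 2 * eps * kap * D.
  apply: le_trans (hs _ t1); rewrite ler_wpM2l// -RintegralZl//; last first.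
    exact: cintegrable_cabs.
  have e1 : cintegral mu E (creal \1_E) = Complex mE' 0.
    rewrite cintegral_real (_ : \int[mu]_(x in E) _ = mE')//.
    under eq_Rintegral => x xE do rewrite indicE xE.
    by rewrite Rintegral_cst// mul1r.
  have e2 : cintegral mu E (fun y => b y * creal \1_E y) = Complex mE' 0 * c.
    rewrite -cE; apply: eq_cintegral => y yE.
    by rewrite /creal indicE yE -[Complex _ _]/(1 : R[i]) mulr1.
  rewrite e1 e2 le_eqVlt; apply/orP; left; apply/eqP; apply: eq_Rintegral => x _.
  by rewrite (mulrC (b x)) -mulrBr cabsM cabs_real gtr0_norm.
(* For every [x], the integral of [(b - c) * su] over [E] is [- (b x * F - G) + F * (b x - c)].
   After integration over [B] the first term is bounded by the commutator estimate for [su] and the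
   second by [s1], since [cabs F <= mE']; the coefficients 2 and 4 add up the two bounds. *)
have part (u : X -> R) (su : X -> R) : test_function su ->
    \int[mu]_(y in E) `|u y| <= cabs (cintegral mu E (fun y => (b y - c) * creal su y)) ->
    kap * (mB' * \int[mu]_(y in E) `|u y|) <= 2 * tau + 4 * eps * kap * D.
  move=> tsu hu; set I := \int[mu]_(y in E) `|u y|.
  set F := cintegral mu E (creal su).
  set G := cintegral mu E (fun y => b y * creal su y).
  have msE : cmeasurable_on E (creal su).
    by apply: cmeasurable_onW => //; apply: cmeasurable_on_real; case: tsu.
  have su1 y : E y -> cabs (creal su y) <= 1.
    by rewrite /creal cabs_real; case: tsu.
  have isu : cintegrable mu E (creal su).
    exact: (@cintegrable_bounded _ _ _ _ _ _ 1).
  have ibsu : cintegrable mu E (fun y => b y * creal su y).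
    have := cintegrableMl mE msE su1 bE.
    by under eq_fun do rewrite mulrC.
  have Fle : cabs F <= mE'.
    rewrite /F cintegral_real cabs_real.
    have isR : mu.-integrable E (EFin \o su) by exact: (cintegrable_Re mE isu).
    apply: le_trans (le_normr_Rintegral mE isR) _.
    rewrite -[leRHS]mul1r -Rintegral_cst//; apply: le_Rintegral => //.
    - exact: integrable_norm.
    - apply/integrableP; split; first exact: measurable_cst.
      by rewrite /= integral_cst// lte_mul_pinfty.
    - by move=> y _; case: tsu.
  have cG : cintegral mu E (fun y => (b y - c) * creal su y) = G - c * F.
    rewrite -cintegralZl// -cintegralB//.
      by apply: eq_cintegral => y _; rewrite mulrBl.
    by apply: (@cintegrableMl _ _ _ _ _ (fun=> c) _ (cabs c)).
  have Ix x : I <= cabs (b x * F - G) + mE' * cabs (b x - c).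
    apply: le_trans hu _; rewrite cG.
    have -> : G - c * F = - (b x * F - G) + F * (b x - c) by ring.
    apply: le_trans (cabsD _ _) _; rewrite cabsN lerD2l cabsM.
    by apply: ler_wpM2r => //; exact: cabs_ge0.
  have ibF : cintegrable mu B (fun x => b x * F - G).
    apply: cintegrableB => //; last exact: icst.
    have := @cintegrableMl _ _ _ mu B (fun=> F) b (cabs F) mB
      (cmeasurable_on_cst _ _) (fun _ _ => lexx _) bB.
    by under eq_fun do rewrite mulrC.
  have i2 : mu.-integrable B (EFin \o (fun x => mE' * cabs (b x - c))).
    by have := integrableZl mB mE' (cintegrable_cabs ibcB).
  have : I * mB' <= \int[mu]_(x in B) cabs (b x * F - G) + mE' * A.
    rewrite -RintegralZl//; last exact: cintegrable_cabs.
    rewrite -RintegralD//; last exact: cintegrable_cabs.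
    rewrite -Rintegral_cst//; apply: le_Rintegral => //.
    - apply/integrableP; split; first exact: measurable_cst.
      by rewrite /= integral_cst// lte_mul_pinfty.
    - exact: (integrableD mB (cintegrable_cabs ibF) i2).
  move=> /(ler_wpM2l kap0); rewrite mulrDr (mulrC I) => /le_trans; apply.
  have := lerD (hs _ tsu) s1; rewrite -/F -/G => /le_trans; apply.
  by rewrite le_eqVlt; apply/orP; left; apply/eqP; ring.
(* The value at the zeros of [u] in [E] is 1 rather than 0, which leaves a combination of
   indicators. *)
pose sgn (u : X -> R) y : R := \1_E y * (2 * \1_[set y | 0 <= u y] y - 1).
have tsgn u : measurable_fun setT u -> test_function (sgn u).
  move=> mu_; split.
  - apply: measurable_funM; first exact: measurable_indic.
    apply: measurable_funB => //; apply: measurable_funM => //.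
    apply: measurable_indic.
    rewrite (_ : [set y | _] = setT `&` u @^-1` `[0, +oo[).
      exact: mu_.
    by apply/seteqP; split => y /=; rewrite in_itv /= andbT; tauto.
  - move=> y; rewrite /sgn !indicE; case: (y \in E); case: (y \in _);
    by rewrite ?mul0r ?mul1r ?normr0// ?mulr1 ?mulr0 ?sub0r ?normrN ?normr1//
      (_ : 2 - 1 = 1) ?normr1//; lra.
  - by move=> y Ey; rewrite /sgn indicE memNset// mul0r.
have sgnE u y : y \in E -> u y * sgn u y = `|u y|.
  move=> yE; rewrite /sgn !indicE yE mul1r.
  have [uy|uy] := leP 0 (u y).
    by rewrite mem_set//= mulr1 ger0_norm//; ring.
  by rewrite memNset /= ?ltr0_norm//; [ring|move=> /=; apply/negP; rewrite -ltNge].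
have mc : cmeasurable (bc c).
  by apply: cmeasurable_onB => //; exact: cmeasurable_on_cst.
have pR := part _ _ (tsgn _ mc.1).
have pI := part _ _ (tsgn _ mc.2).
have {}pR := pR (fun y => complex.Re (b y - c)).
have {}pI := pI (fun y => complex.Im (b y - c)).
set IR := \int[mu]_(y in E) `|complex.Re (b y - c)| in pR.
set II := \int[mu]_(y in E) `|complex.Im (b y - c)| in pI.
have {}pR : kap * (mB' * IR) <= 2 * tau + 4 * eps * kap * D.
  apply: pR; apply: le_trans (ler_norm _) _; apply: le_trans (normr_Re_cabs _).
  rewrite Re_cintegral le_eqVlt; apply/orP; left; apply/eqP; congr (`| _ |).
  apply: eq_Rintegral => y yE.
  by rewrite [in RHS]ReM /= mulr0 subr0 (sgnE (fun y => complex.Re (b y - c))).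
have {}pI : kap * (mB' * II) <= 2 * tau + 4 * eps * kap * D.
  apply: pI; apply: le_trans (ler_norm _) _; apply: le_trans (normr_Im_cabs _).
  rewrite Im_cintegral le_eqVlt; apply/orP; left; apply/eqP; congr (`| _ |).
  apply: eq_Rintegral => y yE.
  by rewrite [in RHS]ImM /= mulr0 add0r (sgnE (fun y => complex.Im (b y - c))).
have EoI : Eo <= IR + II.
  have iR := integrable_norm (cintegrable_Re mE ibcE).
  have iI := integrable_norm (cintegrable_Im mE ibcE).
  rewrite -RintegralD//; apply: le_Rintegral => //.
  - exact: cintegrable_cabs.
  - exact: (integrableD mE iR iI).
  - by move=> y _; exact: cabs_ReIm.
have kD : kap * D <= 10 * tau.
  have h1 : kap * (mB' * Eo) <= kap * (mB' * IR) + kap * (mB' * II).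
    by rewrite -!mulrDr; apply: ler_wpM2l => //; rewrite ler_pM2l.
  have h2 : kap * D = kap * (mE' * A) + kap * (mB' * Eo) by rewrite -mulrDr.
  move: s1 pR pI; rewrite -!(mulrA _ kap D) eps20; lra.
have kA : kap * (mE' * A) <= 10 * tau.
  apply: le_trans kD; apply: ler_wpM2l => //; rewrite lerDl mulr_ge0// ltW//.
(* The difference of the two means is at most [2 * A / mB'], the 2 coming from [cabs_cintegral];
   with [A] itself this makes 3. *)
suff A3 : \int[mu]_(x in B) cabs (b x - caverage mu B b) <= 3 * A.
  apply: (@le_trans _ _ (kap * mE' * (3 * A))).
    by apply: ler_wpM2l => //; rewrite mulr_ge0// ltW.
  by lra.
set cB := caverage mu B b.
have cBE : cintegral mu B (bc c) = Complex mB' 0 * (cB - c).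
  rewrite cintegralB//; last exact: icst.
  rewrite cintegral_cst// mulrBr; congr (_ - _).
  by rewrite /cB caverageK.
have hB : mB' * cabs (cB - c) <= 2 * A.
  rewrite -[X in X * _](gtr0_norm (B0 : 0 < mB')) -cabs_real -cabsM -cBE.
  exact: cabs_cintegral.
have ic' : mu.-integrable B (EFin \o (fun=> cabs (cB - c))).
  apply/integrableP; split; first exact: measurable_cst.
  by rewrite /= integral_cst// lte_mul_pinfty.
apply: (@le_trans _ _ (A + mB' * cabs (cB - c))); last lra.
rewrite (mulrC mB') -Rintegral_cst// -RintegralD//; last exact: cintegrable_cabs.
apply: le_Rintegral => //.
- by apply: cintegrable_cabs; apply: cintegrableB => //; exact: icst.
- exact: (integrableD mB (cintegrable_cabs ibcB) ic').
- by move=> x _; rewrite [cabs (cB - c)]cabsB; exact: cabs_triangle.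
Qed.

End commutator_lower_bound.

(** * Weights *)

Section weighted_means.
Context (R : realType).

Lemma powR_expR (a x : R) : 0 < a -> a `^ x = expR (x * ln a).
Proof. by move=> a0; rewrite /powR gt_eqF. Qed.

(** Weighted AM-GM by concavity of the logarithm. Zero weights are allowed, so that the two-factor
    inequality is a special case. *)
Lemma powR_weighted_mean_le (a b c u v w : R) :
  0 <= a -> 0 <= b -> 0 <= c -> a + b + c = 1 -> 0 < u -> 0 < v -> 0 < w ->
  u `^ a * v `^ b * w `^ c <= a * u + b * v + c * w.
Proof.
move=> a0 b0 c0 abc u0 v0 w0.
set m := a * u + b * v + c * w.
have m0 : 0 < m.
  (* As some weights may vanish, positivity of the mean comes from comparison with the smallest of
     the three numbers. *)
  pose z := Num.min u (Num.min v w).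
  have z0 : 0 < z by rewrite !lt_min u0 v0.
  have zu : z <= u by rewrite ge_min lexx.
  have zv : z <= v by rewrite !ge_min lexx orbT.
  have zw : z <= w by rewrite !ge_min lexx !orbT.
  apply: lt_le_trans z0 _.
  have -> : z = a * z + b * z + c * z by rewrite -!mulrDl abc mul1r.
  by rewrite !lerD// ler_wpM2l.
(* The tangent line of [ln] at the mean [m]; in the weighted sum the linear terms cancel. *)
have lnm t : 0 < t -> ln t <= ln m + (t / m - 1).
  move=> t0; rewrite -lerBlDl -ln_div ?posrE//.
  have tm : 0 < t / m by rewrite divr_gt0.
  have := le_ln1Dx (_ : -1 < t / m - 1).
  by rewrite addrCA subrr addr0; apply; rewrite ltrBDr addNr.
rewrite !powR_expR// -!expRD -[leRHS]lnK ?posrE// ler_expR.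
have := lnm _ u0 => /(ler_wpM2l a0) hu.
have := lnm _ v0 => /(ler_wpM2l b0) hv.
have := lnm _ w0 => /(ler_wpM2l c0) hw.
apply: le_trans (lerD (lerD hu hv) hw) _.
rewrite le_eqVlt; apply/orP; left; apply/eqP.
have -> : a * (ln m + (u / m - 1)) + b * (ln m + (v / m - 1)) +
  c * (ln m + (w / m - 1)) = (a + b + c) * (ln m - 1) + m / m.
  by rewrite /m; ring.
by rewrite abc mul1r divff ?gt_eqF// subrK.
Qed.

End weighted_means.

Section integrals_of_weights.
Context (R : realType) d (X : measurableType d).
Variables (mu : {measure set X -> \bar R}) (B : set X).
Hypotheses (mB : measurable B) (B0 : (0 < mu B)%E) (Boo : (mu B < +oo)%E).

(** A zero integral would make the function vanish almost everywhere on [B], against its positivity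
    and that of [mu B]. *)
Lemma gt0_integral_gt0 (f : X -> R) : measurable_fun B f ->
  (forall x, 0 < f x) -> (0 < \int[mu]_(x in B) (f x)%:E)%E.
Proof.
move=> mf f0; rewrite lt_neqAle; apply/andP; split; last first.
  by apply: integral_ge0 => x _; rewrite lee_fin ltW.
apply/eqP => /esym i0.
have : (\int[mu]_(x in B) `|(f x)%:E| = 0)%E.
  by rewrite -i0; apply: eq_integral => x _; rewrite gee0_abs// lee_fin ltW.
move=> /ae_eq_integral_abs h.
have [||N [mN N0 BN]] := h _ _ => //; first exact/measurable_EFinP.
suff : (mu B <= 0)%E by rewrite leNgt B0.
rewrite -N0; apply: le_measure; rewrite ?inE// => x Bx; apply: BN => /= /(_ Bx).
by move=> -[] /eqP; rewrite gt_eqF.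
Qed.

Lemma gt0_Rintegral_gt0 (f : X -> R) : mu.-integrable B (EFin \o f) ->
  (forall x, 0 < f x) -> 0 < \int[mu]_(x in B) f x.
Proof.
move=> fi f0; rewrite -lte_fin fineK; last exact: integrable_fin_num fi.
by apply: gt0_integral_gt0 => //; apply/measurable_EFinP; exact: measurable_int fi.
Qed.

(* Integrate the weighted AM-GM inequality for the normalised functions
   [f / \int f], [g / \int g], [h / \int h]. *)
Lemma hoelder3_cst1 (a b c : R) (f g h : X -> R) :
  0 <= a -> 0 <= b -> 0 <= c -> a + b + c = 1 ->
  (forall x, 0 < f x) -> (forall x, 0 < g x) -> (forall x, 0 < h x) ->
  mu.-integrable B (EFin \o f) -> mu.-integrable B (EFin \o g) ->
  mu.-integrable B (EFin \o h) ->
  (forall x, f x `^ a * g x `^ b * h x `^ c = 1) ->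
  fine (mu B) <= (\int[mu]_(x in B) f x) `^ a * (\int[mu]_(x in B) g x) `^ b *
    (\int[mu]_(x in B) h x) `^ c.
Proof.
move=> a0 b0 c0 abc f0 g0 h0 fi gi hi fgh.
have F0 := gt0_Rintegral_gt0 fi f0; have G0 := gt0_Rintegral_gt0 gi g0.
have H0 := gt0_Rintegral_gt0 hi h0.
set F := \int[mu]_(x in B) f x in F0 *; set G := \int[mu]_(x in B) g x in G0 *.
set H := \int[mu]_(x in B) h x in H0 *.
set P := F `^ a * G `^ b * H `^ c.
have P0 : 0 < P by rewrite !mulr_gt0// powR_gt0.
have iZ (r : R) (u : X -> R) : mu.-integrable B (EFin \o u) ->
    mu.-integrable B (EFin \o (fun x => r * u x)).
  by move=> ui; have := integrableZl mB r ui.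
have i1 := iZ (a / F) _ fi; have i2 := iZ (b / G) _ gi; have i3 := iZ (c / H) _ hi.
have i12 : mu.-integrable B (EFin \o (fun x => a / F * f x + b / G * g x)).
  exact: (integrableD mB i1 i2).
have i123 : mu.-integrable B
    (EFin \o (fun x => a / F * f x + b / G * g x + c / H * h x)).
  exact: (integrableD mB i12 i3).
have : \int[mu]_(x in B) 1 <=
    \int[mu]_(x in B) (P * (a / F * f x + b / G * g x + c / H * h x)).
  apply: le_Rintegral => //; last 2 first.
  - exact: iZ.
  - move=> x _; rewrite -(fgh x).
    have := powR_weighted_mean_le a0 b0 c0 abc (divr_gt0 (f0 x) F0)
      (divr_gt0 (g0 x) G0) (divr_gt0 (h0 x) H0).
    rewrite -(ler_pM2l P0) => hle.
    have scal (u U t : R) : 0 < u -> 0 < U -> u `^ t = U `^ t * (u / U) `^ t.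
      move=> u0 U0; rewrite -powRM ?(ltW U0)//; last exact/ltW/divr_gt0.
      by rewrite mulrC divfK// gt_eqF.
    rewrite (scal (f x) F)// (scal (g x) G)// (scal (h x) H)//.
    rewrite (mulrACA _ _ (G `^ b)) (mulrACA _ _ (H `^ c)).
    apply: (le_trans hle).
    have divM (s u U : R) : s * (u / U) = s / U * u by rewrite mulrA mulrAC.
    by rewrite !divM.
  - apply/integrableP; split; first exact: measurable_cst.
    by rewrite /= integral_cst// lte_mul_pinfty.
rewrite Rintegral_cst// mul1r RintegralZl// RintegralD// RintegralD//.
rewrite !RintegralZl// -/F -/G -/H !divfK ?gt_eqF// abc mulr1.
by [].
Qed.

End integrals_of_weights.

(** Squaring the three-function bound gives [m ^+ 2 <= N ^ s * S1 ^ t * W2 ^ u]. Multiplied by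
    [P1 * P2], the right side contains [P1 * S1 ^ t] and [W2 ^ u * P2], which the weight conditions
    bound by multiples of [m], so [m ^+ 2] cancels. Primed quantities belong to the dilated ball. *)
Lemma powR_bloom_combine (R : realType) (m m' N S1 S1' W2 P1 P2 s t u M1 M2 Cl : R) :
  0 < m -> 0 < N -> 0 < S1 -> 0 < W2 -> 0 <= P1 -> 0 <= P2 -> S1 <= S1' ->
  0 <= t -> 0 <= M2 ->
  m <= N `^ (s / 2) * S1 `^ (t / 2) * W2 `^ (u / 2) ->
  P1 * S1' `^ t <= M1 * m' -> W2 `^ u * P2 <= M2 * m -> m' <= Cl * m -> 0 <= M1 ->
  P1 * P2 <= M1 * Cl * M2 * N `^ s.
Proof.
move=> m0 N0 S10 W20 P10 P20 S1le t0 M20 h3 A1 A2 hC M10.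
have sq z a : 0 < z -> (z `^ (a / 2)) ^+ 2 = z `^ a.
  move=> z0; rewrite -powR_mulrn ?powR_ge0// -powRrM; congr (_ `^ _).
  by rewrite mulfVK.
have m2 : m ^+ 2 <= N `^ s * S1 `^ t * W2 `^ u.
  apply: (@le_trans _ _ ((N `^ (s / 2) * S1 `^ (t / 2) * W2 `^ (u / 2)) ^+ 2)).
    by rewrite ler_pXn2r ?nnegrE ?mulr_ge0 ?powR_ge0 ?(ltW m0).
  by rewrite !exprMn !sq.
have m20 : 0 < m ^+ 2 by rewrite exprn_gt0.
rewrite -(ler_pM2r m20).
apply: (@le_trans _ _ (P1 * P2 * (N `^ s * S1 `^ t * W2 `^ u))).
  by apply: ler_wpM2l => //; rewrite mulr_ge0.
have -> : P1 * P2 * (N `^ s * S1 `^ t * W2 `^ u) =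
    N `^ s * ((P1 * S1 `^ t) * (W2 `^ u * P2)) by ring.
have -> : M1 * Cl * M2 * N `^ s * m ^+ 2 =
    N `^ s * ((M1 * (Cl * m)) * (M2 * m)) by ring.
apply: ler_wpM2l; first exact: powR_ge0.
apply: ler_pM; rewrite ?mulr_ge0 ?powR_ge0//.
apply: (@le_trans _ _ (P1 * S1' `^ t)).
  apply: ler_wpM2l => //; apply: ge0_ler_powR => //; rewrite nnegrE ?(ltW S10)//.
  exact: le_trans (ltW S10) S1le.
by apply: (le_trans A1); apply: ler_wpM2l.
Qed.

(** * Muckenhoupt weights, dual weights and Hoelder bounds *)

Section Ap_weights.
Context (R : realType) d (X : measurableType d) (rho : X -> X -> R) (A0 : R)
  (mu : {measure set X -> \bar R}).
Hypothesis hX : homogeneous_space rho A0 mu.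

Local Notation m x r := (fine (mu (qball rho x r))).

Lemma measurable_powR_comp (f : X -> R) (a : R) : measurable_fun setT f ->
  measurable_fun setT (fun x => f x `^ a).
Proof. by move=> mf; apply: (measurableT_comp (measurable_powR a)). Qed.

(** The [A_p] condition raised to the power [1 / p]. The dual weight is integrable on balls because
    an infinite integral, multiplied by positive factors, would make the supremum infinite. *)
Lemma Ap_dual_integrals (p : R) (w : X -> R) : 1 < p ->
  Ap_weight rho mu p w -> exists2 M : R, 0 < M & forall x r, 0 < r ->
    [/\ mu.-integrable (qball rho x r) (EFin \o w),
      mu.-integrable (qball rho x r) (EFin \o (fun y => w y `^ (- (p - 1)^-1))) &
      (\int[mu]_(y in qball rho x r) w y) `^ p^-1 *
      (\int[mu]_(y in qball rho x r) w y `^ (- (p - 1)^-1)) `^ ((p - 1) / p)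
      <= M * m x r].
Proof.
move=> p1 hw; have w0 := Ap_gt0 hw; have mw := Ap_measurable hw.
have p0 : 0 < p by exact: lt_trans p1.
have pm0 : 0 < p - 1 by rewrite subr_gt0.
set sigma := fun y => w y `^ _.
have s0 y : 0 < sigma y by exact: powR_gt0.
have ms : measurable_fun setT sigma by exact: measurable_powR_comp.
pose M1 := Num.max (fine (Ap_constant rho mu p w)) 1.
have M10 : 0 < M1 by rewrite lt_max ltr01 orbT.
exists (M1 `^ p^-1); first exact: powR_gt0.
move=> x r r0; set B := qball rho x r.
have mB : measurable B by exact: hspace_ball_measurable hX _ _ r0.
have B0 := hspace_ball_gt0 hX x r0.
have mwB : measurable_fun B w by exact: (measurable_funS measurableT).
have msB : measurable_fun B sigma by exact: (measurable_funS measurableT).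
have iw : mu.-integrable B (EFin \o w).
  apply/integrableP; split; first exact/measurable_EFinP.
  under eq_integral do rewrite /= gtr0_norm//.
  exact: (Ap_locally_integrable hw).
have m0 : 0 < m x r by exact: fine_qball_gt0 hX _ _ r0.
have W0 := gt0_Rintegral_gt0 mB B0 iw w0.
set W := \int[mu]_(y in B) w y in W0 *.
have WE : (\int[mu]_(y in B) (w y)%:E = W%:E)%E.
  by rewrite /W /Rintegral fineK//; exact: integrable_fin_num iw.
set S := (\int[mu]_(y in B) (sigma y)%:E)%E.
have S0 : (0 < S)%E by exact: gt0_integral_gt0.
have hsup : ((m x r `^ (- p))%:E * W%:E * S `^ (p - 1) <= Ap_constant rho mu p w)%E.
  by apply: ereal_sup_ubound; exists x, r; split => //=; rewrite -/B WE.
have mp0 : 0 < m x r `^ (- p) by exact: powR_gt0.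
have Soo : (S < +oo)%E.
  rewrite ltNge leye_eq; apply/negP => /eqP SE.
  move: hsup; rewrite SE poweRyr ?gt_eqF// -EFinM gt0_muley ?lte_fin ?mulr_gt0//.
  by rewrite leNgt (Ap_constant_fin hw).
have is_ : mu.-integrable B (EFin \o sigma).
  apply/integrableP; split; first exact/measurable_EFinP.
  by under eq_integral do rewrite /= gtr0_norm//.
split => //.
set S' := \int[mu]_(y in B) sigma y.
have SE : S = S'%:E by rewrite /S' /Rintegral fineK//; exact: integrable_fin_num is_.
have S'0 : 0 < S' by rewrite -lte_fin -SE.
have hM : m x r `^ (- p) * W * S' `^ (p - 1) <= M1.
  move: hsup; rewrite SE poweR_EFin -!EFinM => hsup.
  rewrite le_max -lee_fin; apply/orP; left.
  apply: (le_trans hsup); rewrite fineK// ge0_fin_numE ?(Ap_constant_fin hw)//.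
  apply: le_trans hsup; rewrite lee_fin !mulr_ge0 ?ltW ?powR_gt0//.
have -> : W `^ p^-1 * S' `^ ((p - 1) / p) = (W * S' `^ (p - 1)) `^ p^-1.
  by rewrite powRM ?ltW ?powR_gt0// -powRrM.
have -> : M1 `^ p^-1 * m x r = (M1 * m x r `^ p) `^ p^-1.
  by rewrite powRM ?ltW ?powR_gt0// -powRrM mulfV ?gt_eqF// powRr1// ltW.
apply: ge0_ler_powR; rewrite ?nnegrE ?invr_ge0 ?(ltW p0)//.
- by rewrite ltW// mulr_gt0// powR_gt0.
- by rewrite ltW// mulr_gt0// powR_gt0.
move: hM; rewrite powRN -mulrA -ler_pdivlMl ?invr_gt0 ?powR_gt0// invrK.
by rewrite mulrC (mulrC M1).
Qed.

(** Hoelder's inequality for [cabs h * lambda] and the inverse of [lambda] on [B]. The power [- q']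
    of [lambda] is written as the dual weight of [lambda ^ q], the form in which the [A_q] condition
    supplies it. *)
Lemma le_lnorm_hoelder (q : R) (lambda : X -> R) (B : set X) (h : X -> R[i])
    (N : R) : 1 < q -> measurable B -> measurable_fun setT lambda ->
  (forall x, 0 < lambda x) -> cmeasurable h ->
  mu.-integrable B (EFin \o (fun y => (lambda y `^ q) `^ (- (q - 1)^-1))) ->
  (Lp_norm mu q lambda h <= N%:E)%E ->
  (\int[mu]_(x in B) (cabs (h x))%:E <=
    (N * (\int[mu]_(y in B) (lambda y `^ q) `^ (- (q - 1)^-1)) `^ ((q - 1) / q))%:E)%E.
Proof.
move=> q1 mB ml l0 mh is_ hN.
have q0 : 0 < q by exact: lt_trans q1.
have qm0 : 0 < q - 1 by rewrite subr_gt0.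
pose q' := q / (q - 1).
have q'0 : 0 < q' by exact: divr_gt0.
have qq' : q^-1 + q'^-1 = 1.
  by rewrite /q'; field; rewrite !gt_eqF.
pose f x := cabs (h x) * lambda x.
pose g x := \1_B x * lambda x `^ (-1).
have mf : measurable_fun setT f.
  by apply: measurable_funM => //; exact: measurable_cabs.
have mg : measurable_fun setT g.
  by apply: measurable_funM; [exact: measurable_indic|exact: measurable_powR_comp].
have := hoelder mu mf mg q0 q'0 qq'.
set L := Lnorm mu 1 _; set N1 := Lnorm mu q%:E _; set N2 := Lnorm mu q'%:E _ => hh.
have LE : (\int[mu]_(x in B) (cabs (h x))%:E = L)%E.
  rewrite /L Lnorm1 (@integral_zero_outside _ _ _ mu B); last first.
    by move=> x Bx; rewrite /= /g indicE memNset//= mul0r mulr0 normr0.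
  apply: eq_integral => x xB.
  rewrite /= /f /g indicE xB mul1r powR_inv1 ?ltW// mulfK ?gt_eqF//.
  by rewrite ger0_norm// cabs_ge0.
have N2E : (N2 = ((\int[mu]_(y in B) (lambda y `^ q) `^ (- (q - 1)^-1))
    `^ ((q - 1) / q))%:E)%E.
  rewrite /N2 unlock (@integral_zero_outside _ _ _ mu B); last first.
    by move=> x Bx; rewrite /= /g indicE memNset// mul0r normr0 powR0// gt_eqF.
  have -> : q'^-1 = (q - 1) / q by rewrite /q' invf_div.
  rewrite -poweR_EFin; congr (_ `^ _)%E.
  rewrite /Rintegral fineK; last exact: integrable_fin_num is_.
  apply: eq_integral => x xB; rewrite /= /g indicE xB mul1r; congr EFin.
  rewrite ger0_norm; last exact: powR_ge0.
  rewrite -powRrM -powRrM; congr (_ `^ _).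
  by rewrite /q'; field; rewrite gt_eqF.
rewrite LE EFinM -N2E; apply: le_trans hh _; apply: lee_wpmul2r => //.
exact: Lnorm_ge0.
Qed.

Lemma le_Lp_norm_integral (p : R) (lambda : X -> R) (E : set X) (f : X -> R[i]) :
  1 < p -> measurable E -> measurable_fun setT lambda ->
  (forall x, 0 < lambda x) -> cmeasurable f ->
  mu.-integrable E (EFin \o (fun y => lambda y `^ p)) ->
  (forall x, ~ E x -> f x = 0) -> (forall x, cabs (f x) <= 1) ->
  (Lp_norm mu p lambda f <= ((\int[mu]_(y in E) lambda y `^ p) `^ p^-1)%:E)%E.
Proof.
move=> p1 mE ml l0 mf il f0 f1; have p0 : 0 < p by exact: lt_trans p1.
have ip0 : 0 <= p^-1 by rewrite invr_ge0 ltW.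
rewrite /Lp_norm unlock (@integral_zero_outside _ _ _ mu E); last first.
  by move=> x /f0 ->; rewrite cabs0 mul0r abse0 poweR0r// gt_eqF.
rewrite -poweR_EFin; apply: gt0_ler_poweR => //.
- by rewrite in_itv /= leey andbT; apply: integral_ge0 => x _; rewrite lee_fin powR_ge0.
- by rewrite in_itv /= leey andbT lee_fin; apply: Rintegral_ge0 => x _; exact: powR_ge0.
rewrite /Rintegral fineK; last exact: integrable_fin_num il.
apply: ge0_le_integral => //.
- by move=> x _; exact: poweR_ge0.
- apply: (measurable_funS measurableT) => //.
  have mc : measurable_fun setT (fun x => cabs (f x) * lambda x).
    by apply: measurable_funM => //; exact: measurable_cabs.
  have -> : (fun x => (`|(cabs (f x) * lambda x)%:E| `^ p)%E) =
      EFin \o (fun x => (cabs (f x) * lambda x) `^ p).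
    by apply/funext => x /=; rewrite ger0_norm// mulr_ge0 ?cabs_ge0 ?ltW.
  by apply/measurable_EFinP; exact: measurable_powR_comp.
- exact: (measurable_int mu il).
move=> x _; rewrite abse_EFin poweR_EFin lee_fin.
rewrite ger0_norm; last by rewrite mulr_ge0 ?cabs_ge0 ?ltW.
apply: ge0_ler_powR; rewrite ?nnegrE ?(ltW p0) ?(ltW (l0 x))//.
  by rewrite mulr_ge0 ?cabs_ge0 ?ltW.
by rewrite ler_piMl// ltW.
Qed.

(** * The fractional Bloom weight *)

Section bloom.
Variables (p q : R) (lambda1 lambda2 : X -> R).
Hypotheses (p1 : 1 < p) (q1 : 1 < q).
Hypothesis hl1 : App_weight rho mu p lambda1.
Hypothesis hl2 : App_weight rho mu q lambda2.

(** The weight condition provides measurability of the power [lambda ^ r]; positivity of [lambda]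
    allows taking the root. *)
Lemma App_weight_measurable (r : R) (lambda : X -> R) : 0 < r ->
  App_weight rho mu r lambda -> measurable_fun setT lambda.
Proof.
move=> r0 [l0 hl].
rewrite (_ : lambda = fun x => (lambda x `^ r) `^ r^-1).
  exact: measurable_powR_comp (Ap_measurable hl).
by apply/funext => x; rewrite -powRrM mulfV ?gt_eqF// powRr1// ltW.
Qed.

Local Notation nu := (bloom_weight p q lambda1 lambda2).
(** The dual weights are [lambda1 ^ (- p')] and [lambda2 ^ (- q')]; the exponent [S] is
    [1/p + 1/q']. *)
Local Notation sigma1 := (fun y => (lambda1 y `^ p) `^ (- (p - 1)^-1)).
Local Notation sigma2 := (fun y => (lambda2 y `^ q) `^ (- (q - 1)^-1)).
Local Notation S := (p^-1 + (q - 1) / q).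

Let p0 : 0 < p. Proof. exact: lt_trans p1. Qed.
Let q0 : 0 < q. Proof. exact: lt_trans q1. Qed.
Let pm0 : 0 < p - 1. Proof. by rewrite subr_gt0. Qed.
Let qm0 : 0 < q - 1. Proof. by rewrite subr_gt0. Qed.
Let S0 : 0 < S.
Proof. by rewrite addr_gt0// ?invr_gt0// divr_gt0. Qed.
Let l10 := hl1.1.
Let l20 := hl2.1.

Let nuE x : nu x = (lambda1 x / lambda2 x) `^ S^-1.
Proof. by rewrite /bloom_weight /conjugate_exponent invf_div. Qed.

Lemma bloom_weight_gt0 x : 0 < nu x.
Proof. by rewrite nuE powR_gt0// divr_gt0. Qed.

(** The weight is a geometric mean of [lambda1 ^ p] and [sigma2], with exponents [1 / (p S)] and
    [1 / (q' S)] of sum 1, hence at most their arithmetic mean, which is integrable on balls. *)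
Lemma bloom_weight_integrable x r : 0 < r ->
  mu.-integrable (qball rho x r) (EFin \o nu).
Proof.
move=> r0; set B := qball rho x r.
have mB : measurable B by exact: hspace_ball_measurable hX _ _ r0.
have [M1 _ /(_ x r r0)[i1 _ _]] := Ap_dual_integrals p1 hl1.2.
have [M2 _ /(_ x r r0)[_ i2 _]] := Ap_dual_integrals q1 hl2.2.
pose a := S^-1 * p^-1; pose b := S^-1 * ((q - 1) / q).
have ia := integrableZl mB a i1; have ib := integrableZl mB b i2.
have iab := integrableD mB ia ib.
apply: (le_integrable mB _ _ iab).
  apply/measurable_EFinP; apply: (measurable_funS measurableT) => //.
  rewrite (_ : nu = fun y => (lambda1 y / lambda2 y) `^ S^-1); last exact/funext.
  apply: measurable_powR_comp; apply: measurable_funM.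
    exact: App_weight_measurable hl1.
  rewrite (_ : (fun _ => _) = fun x => lambda2 x `^ (-1)).
    by apply: measurable_powR_comp; exact: App_weight_measurable hl2.
  by apply/funext => y; rewrite powR_inv1// ltW.
move=> y _; rewrite /= lee_fin gtr0_norm ?bloom_weight_gt0//.
apply: le_trans (ler_norm _).
have ab : a + b + 0 = 1.
  by rewrite addr0 /a /b -mulrDr mulVf// gt_eqF.
have a0 : 0 <= a by apply/ltW; rewrite mulr_gt0 ?invr_gt0.
have b0 : 0 <= b by apply/ltW; rewrite mulr_gt0 ?invr_gt0// divr_gt0.
have := powR_weighted_mean_le a0 b0 (lexx 0) ab (powR_gt0 p (l10 y))
  (powR_gt0 (- (q - 1)^-1) (powR_gt0 q (l20 y))) ltr01.
rewrite powRr0 mul0r addr0 mulr1; apply: le_trans.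
rewrite nuE le_eqVlt; apply/orP; left; apply/eqP.
rewrite -!powRrM !powR_expR ?divr_gt0// -expRD; congr expR.
rewrite ln_div ?posrE// /a /b; move: (S^-1) => t; field.
by rewrite !gt_eqF.
Qed.

(** The dilated ball makes room for test functions living on a ball near [B]. The [A_p] condition is
    used on the dilate, the [A_q] condition on [B], and doubling compares the two measures. *)
Lemma bloom_weight_bound (lam : R) : 1 <= lam -> exists2 C : R, 0 < C &
  forall x r, 0 < r ->
    (\int[mu]_(y in qball rho x (lam * r)) lambda1 y `^ p) `^ p^-1 *
    (\int[mu]_(y in qball rho x r) sigma2 y) `^ ((q - 1) / q)
    <= C * (\int[mu]_(y in qball rho x r) nu y) `^ S.
Proof.
move=> lam1; have lam0 : 0 < lam by exact: lt_le_trans lam1.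
have [M1 M10 hM1] := Ap_dual_integrals p1 hl1.2.
have [M2 M20 hM2] := Ap_dual_integrals q1 hl2.2.
have [Cl Cl0 hCl] := doubling_iter hX lam0.
exists (M1 * Cl * M2); first by rewrite !mulr_gt0.
move=> x r r0; have lr0 : 0 < lam * r by rewrite mulr_gt0.
set B := qball rho x r; set B' := qball rho x (lam * r).
have mB : measurable B by exact: hspace_ball_measurable hX _ _ r0.
have mB' : measurable B' by exact: hspace_ball_measurable hX _ _ lr0.
have B0 := hspace_ball_gt0 hX x r0; have Boo := hspace_ball_fin hX x r0.
have B'0 := hspace_ball_gt0 hX x lr0.
have BB' : B `<=` B'.
  by move=> y /= /lt_le_trans; apply; rewrite ler_peMl// ltW.
have [i1' s1' A1] := hM1 x _ lr0; have [i2 s2 A2] := hM2 x _ r0.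
rewrite -/B' in i1' s1' A1; rewrite -/B in i2 s2 A2.
have s1 := integrableS mB' mB BB' s1'.
have inu := bloom_weight_integrable x r0.
have w1 y : 0 < lambda1 y `^ p by exact: powR_gt0.
have w2 y : 0 < lambda2 y `^ q by exact: powR_gt0.
have sg1 y : 0 < sigma1 y by exact: powR_gt0.
have sg2 y : 0 < sigma2 y by exact: powR_gt0.
(* Pointwise, [nu ^ S], [sigma1 ^ ((p - 1) / p)] and [(lambda2 ^ q) ^ (1 / q)] are
   [lambda1 / lambda2], [1 / lambda1] and [lambda2], of product 1. The exponents add up to 2 and are
   halved for Hoelder. *)
have abc : S / 2 + (p - 1) / p / 2 + q^-1 / 2 = 1.
  by field; rewrite !gt_eqF.
have h3 : fine (mu B) <= (\int[mu]_(y in B) nu y) `^ (S / 2) *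
    (\int[mu]_(y in B) sigma1 y) `^ ((p - 1) / p / 2) *
    (\int[mu]_(y in B) lambda2 y `^ q) `^ (q^-1 / 2).
  apply: (hoelder3_cst1 mB B0 Boo _ _ _ abc bloom_weight_gt0 sg1 w2 inu s1 i2);
    rewrite ?divr_ge0 ?(ltW S0) ?(ltW p0) ?(ltW q0) ?(ltW pm0)//.
    by rewrite invr_ge0 ltW.
  move=> y; rewrite nuE -!powRrM !powR_expR ?divr_gt0// -!expRD.
  rewrite -[RHS]expR0; congr expR; rewrite ln_div ?posrE//.
  have := S0; move: S => t t0; field.
  by rewrite !gt_eqF.
have N0 := gt0_Rintegral_gt0 mB B0 inu bloom_weight_gt0.
have S10 := gt0_Rintegral_gt0 mB B0 s1 sg1.
have W20 := gt0_Rintegral_gt0 mB B0 i2 w2.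
have S1le : \int[mu]_(y in B) sigma1 y <= \int[mu]_(y in B') sigma1 y.
  rewrite -lee_fin /Rintegral fineK; last exact: integrable_fin_num s1.
  rewrite fineK; last exact: integrable_fin_num s1'.
  apply: ge0_subset_integral => //; first exact: (measurable_int mu s1').
  by move=> y _; rewrite lee_fin ltW.
have m0 : 0 < m x r by exact: fine_qball_gt0 hX _ _ r0.
have t0 : 0 <= (p - 1) / p by rewrite divr_ge0// ltW.
exact: (powR_bloom_combine m0 N0 S10 W20 (powR_ge0 _ _) (powR_ge0 _ _) S1le t0
  (ltW M20) h3 A1 A2 (hCl x r r0) (ltW M10)).
Qed.

End bloom.

End Ap_weights.

(** * From the commutator bound to the oscillation on a ball *)

(** Non-degeneracy and doubling give [k * mE >= 1 / (Cm * Cl)], so this factor can be divided out at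
    the price of a constant. *)
Lemma le_of_scaled_bound (R : realFieldType)
    (Cm Cl Cb mB mE k I th P1 P2 N : R) :
  0 < Cm -> 0 < Cl -> 0 < mE -> 0 < mB -> 0 <= I -> 0 <= th ->
  mB <= Cl * mE -> (Cm * mB)^-1 <= k -> k * mE * I <= 30 * (th * P1 * P2) ->
  P1 * P2 <= Cb * N -> I <= 30 * Cm * Cl * Cb * th * N.
Proof.
move=> Cm0 Cl0 mE0 mB0 I0 th0 mBE hk hI hP.
have h1 : (Cm * Cl)^-1 <= k * mE.
  rewrite -ler_pdivrMr//; apply: le_trans hk.
  rewrite -invfM lef_pV2 ?posrE ?mulr_gt0//.
  by rewrite -mulrA ler_pM2l.
have h2 : (Cm * Cl)^-1 * I <= 30 * (th * (Cb * N)).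
  apply: (@le_trans _ _ (k * mE * I)); first exact: ler_wpM2r.
  by apply: (le_trans hI); rewrite ler_pM2l// -mulrA; apply: ler_wpM2l.
have CmCl0 : 0 < Cm * Cl by rewrite mulr_gt0.
have : I <= Cm * Cl * (30 * (th * (Cb * N))) by rewrite -ler_pdivrMl.
by move=> /le_trans; apply; rewrite le_eqVlt; apply/orP; left; apply/eqP; ring.
Qed.

Section lower_bound.
Context (R : realType) (d : measure_display) (X : measurableType d)
    (rho : X -> X -> R) (A0 : R) (mu : {measure set X -> \bar R})
    (omega : R -> R) (K : X -> X -> R[i])
    (T T1 : (X -> R[i]) -> (X -> R[i])).
Hypotheses (hX : homogeneous_space rho A0 mu)
    (hT : CZ_operator rho A0 mu omega K T)
    (hT1 : weak_L1_extension mu T T1)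
    (hK : nondegenerate_kernel rho mu K).
Variables (p q : R) (lambda1 lambda2 : X -> R).
Hypotheses (hp : 1 < p) (hq : 1 < q)
    (hlambda1 : App_weight rho mu p lambda1)
    (hlambda2 : App_weight rho mu q lambda2).

Local Notation nu := (bloom_weight p q lambda1 lambda2).
Local Notation m x r := (fine (mu (qball rho x r))).

(** The support is a closure and may leave the ball, but each of its points is within [r] of a point
    of the ball; hence the radius [A0 * (r + r)]. *)
Lemma test_function_Linfty_bs y0 r s : 0 < r ->
  test_function (qball rho y0 r) s -> Linfty_bs rho (creal s).
Proof.
move=> r0 [ms s1 s0]; have hrho := hspace_qmetric hX; split.
- exact: cmeasurable_on_real.
- by exists 1 => y; rewrite /creal cabs_real.
- exists y0, (A0 * (r + r)) => z sz.
  have [y [yz By]] : exists y, rho z y < r /\ qball rho y0 r y.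
    apply: contrapT => nex; apply: (@notin_qclosure _ _ _ _ hrho
      [set x | creal s x != 0] z r r0) sz => y /= sy.
    rewrite leNgt; apply/negP => zy; apply: nex; exists y; split => //.
    by apply: contrapT => /s0 sy0; rewrite /creal sy0 eqxx in sy.
  rewrite /qball /=; apply: le_lt_trans (qmetric_triangle hrho y0 z y) _.
  rewrite (ltr_pM2l (qmetric_A0_gt0 hrho)); apply: ltrD; first exact: By.
  by rewrite (qmetric_sym hrho).
Qed.

(** The constant is fixed before [b], [Theta] and the ball, and the bound holds for every admissible
    [Theta], which prepares the infimum and the supremum in the norms. *)
Lemma oscillation_le_commutator : exists2 C : R, 0 < C &
  forall b Theta, L1loc rho mu b ->
    operator_bound rho mu p lambda1 q lambda2 (commutator T T1 b) Theta ->
    forall x0 r, 0 < r ->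
    \int[mu]_(x in qball rho x0 r)
      cabs (b x - caverage mu (qball rho x0 r) b)
    <= C * Theta * (\int[mu]_(x in qball rho x0 r) nu x)
      `^ (p^-1 + (q - 1) / q).
Proof.
have hrho := hspace_qmetric hX; have A00 := qmetric_A0_gt0 hrho.
have hker := CZ_operator_kernel hT.
have eps0 : 0 < 20^-1 :> R by rewrite invr_gt0.
have [L [Cm [L0 Cm0 hy]]] := kernel_almost_constant hX hker hK eps0.
(* With this dilation the ball about [x0] contains [E], and symmetrically the ball about [y0]
   contains [B], which makes [mu B] at most a multiple of [mu E]. *)
pose lam := A0 * (L + 1).
have lam1 : 1 <= lam.
  by have := qmetric_A0_ge1 hrho; rewrite /lam => A01; apply: mulr_ege1 => //; lra.
have lam0 : 0 < lam by exact: lt_le_trans lam1.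
have [Cl Cl0 hCl] := doubling_iter hX lam0.
have [Cb Cb0 hCb] := bloom_weight_bound hX hp hq hlambda1 hlambda2 lam1.
exists (30 * Cm * Cl * Cb); first by rewrite !mulr_gt0.
move=> b Theta [mb bloc] [th0 hTheta] x0 r r0.
have [y0 [xy kge hk]] := hy x0 r r0.
set B := qball rho x0 r; set E := qball rho y0 r.
have lr0 : 0 < lam * r by rewrite mulr_gt0.
pose B' := qball rho x0 (lam * r).
have mB : measurable B by exact: hspace_ball_measurable hX _ _ r0.
have mE : measurable E by exact: hspace_ball_measurable hX _ _ r0.
have mB' : measurable B' by exact: hspace_ball_measurable hX _ _ lr0.
have EB' : E `<=` B'.
  move=> y Ey; rewrite /B' /qball /=.
  apply: le_lt_trans (qmetric_triangle hrho x0 y y0) _.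
  by rewrite /lam -mulrA ltr_pM2l// mulrDl mul1r; apply: ltrD.
have mBE : m x0 r <= Cl * m y0 r.
  apply: le_trans (hCl y0 r r0); apply: (fine_qball_le hX) => // y By.
  rewrite /qball /=; apply: le_lt_trans (qmetric_triangle hrho y0 y x0) _.
  rewrite /lam -mulrA ltr_pM2l// mulrDl mul1r; apply: ltrD => //.
  by rewrite (qmetric_sym hrho).
have ib z : cintegrable mu (qball rho z r) b.
  split; last exact: bloc.
  by apply: cmeasurable_onW => //; exact: hspace_ball_measurable hX _ _ r0.
have [M1 _ /(_ x0 _ lr0)[i1 _ _]] := Ap_dual_integrals hX hp hlambda1.2.
have [M2 _ /(_ x0 _ r0)[_ i2 _]] := Ap_dual_integrals hX hq hlambda2.2.
have ml1 := App_weight_measurable (lt_trans ltr01 hp) hlambda1.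
have ml2 := App_weight_measurable (lt_trans ltr01 hq) hlambda2.
have BE x : B x -> ~ qclosure rho E x.
  by move=> Bx; apply: (notin_qclosure hrho r0) => y Ey; have [] := hk x y Bx Ey.
have mK x : B x -> cmeasurable_on E (K x).
  move=> Bx; apply: (kernel_measurable hX hker) => // Ex.
  by have [+ _] := hk x x Bx Ex; rewrite (qmetric_xx hrho) leNgt r0.
have Kk x y : B x -> E y -> cabs (K x y - K x0 y0) <= 20^-1 * cabs (K x0 y0).
  by move=> Bx Ey; have [] := hk x y Bx Ey.
have Eoo : (mu E < +oo)%E by exact: hspace_ball_fin hX _ _ r0.
have Boo : (mu B < +oo)%E by exact: hspace_ball_fin hX _ _ r0.
pose P1 := (\int[mu]_(y in B') lambda1 y `^ p) `^ p^-1.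
pose P2 := (\int[mu]_(y in B) (lambda2 y `^ q) `^ (- (q - 1)^-1)) `^ ((q - 1) / q).
have htau s : test_function E s ->
    (\int[mu]_(x in B) (cabs (commutator T T1 b (creal s) x))%:E
      <= (Theta * P1 * P2)%:E)%E.
  move=> hs; have [ms s1 s0] := hs.
  apply: le_lnorm_hoelder => //; first exact: hlambda2.1.
    exact: (commutator_measurable (CZ_operator_measurable hT) hT1 mE Eoo mb (ib y0) hs).
  apply: le_trans (hTheta _ (test_function_Linfty_bs r0 hs)) _.
  rewrite EFinM; apply: lee_wpmul2l; first by rewrite lee_fin.
  apply: le_Lp_norm_integral => //; first exact: hlambda1.1.
  - by move=> y B'y; rewrite /creal s0// => /EB'.
  - by move=> y; rewrite /creal cabs_real.
have mE0 : 0 < m y0 r by exact: fine_qball_gt0 hX _ _ r0.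
have mB0 : 0 < m x0 r by exact: fine_qball_gt0 hX _ _ r0.
have osc := commutator_oscillation (CZ_operator_formula hT)
  (CZ_operator_measurable hT) hT1 mB mE Boo Eoo mb (ib x0) (ib y0) BE mK Kk
  erefl mE0 mB0 htau.
have I0 : 0 <= \int[mu]_(x in B) cabs (b x - caverage mu B b).
  by apply: Rintegral_ge0 => x _; exact: cabs_ge0.
have PP : P1 * P2 <= Cb *
    (\int[mu]_(y in B) nu y) `^ (p^-1 + (q - 1) / q) := hCb x0 r r0.
exact: (le_of_scaled_bound Cm0 Cl0 mE0 mB0 I0 th0 mBE kge osc PP).
Qed.

End lower_bound.

Theorem theorem1p2 (R : realType) (d : measure_display) (X : measurableType d)
    (rho : X -> X -> R) (A0 : R) (mu : {measure set X -> \bar R})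
    (hX : homogeneous_space rho A0 mu)
    (hmuX : mu setT = +oo%E)
    (hatom : forall x0 : X, mu [set x0] = 0%E)
    (omega : R -> R) (K : X -> X -> R[i])
    (T T1 : (X -> R[i]) -> (X -> R[i]))
    (hT : CZ_operator rho A0 mu omega K T)
    (hDini : Dini omega)
    (hT1 : weak_L1_extension mu T T1)
    (hK : nondegenerate_kernel rho mu K)
    (p q alpha : R) (hp : 1 < p) (hpq : p <= q)
    (halpha : alpha / doubling_order rho mu = p^-1 - q^-1)
    (lambda1 lambda2 : X -> R)
    (hlambda1 : App_weight rho mu p lambda1)
    (hlambda2 : App_weight rho mu q lambda2) :
  let nu := bloom_weight p q lambda1 lambda2 in
  exists C : R, 0 < C /\
    forall b : X -> R[i], L1loc rho mu b ->
      bounded_operator rho mu p lambda1 q lambda2 (commutator T T1 b) ->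
      in_BMO rho mu alpha nu b /\
      (BMO_norm rho mu alpha nu b <=
        (C * operator_norm rho mu p lambda1 q lambda2
               (commutator T T1 b))%:E)%E.
Proof.
move=> nu; have hq : 1 < q by exact: lt_le_trans hpq.
have p0 : 0 < p by exact: lt_trans hp.
have q0 : 0 < q by exact: lt_trans hq.
have [C C0 hC] := oscillation_le_commutator hX hT hT1 hK hp hq hlambda1 hlambda2.
exists C; split => // b bloc [th0 hth0].
suff le_norm : (BMO_norm rho mu alpha nu b <=
    (C * operator_norm rho mu p lambda1 q lambda2 (commutator T T1 b))%:E)%E.
  by split => //; split => //; exact: le_lt_trans le_norm (ltry _).
apply: ge_ereal_sup => _ [x [r [r0 ->]]] /=.
set B := qball rho x r.
have mB : measurable B by exact: hspace_ball_measurable hX _ _ r0.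
have B0 := hspace_ball_gt0 hX x r0.
have Boo : (mu B < +oo)%E by exact: hspace_ball_fin hX _ _ r0.
have N0 := gt0_Rintegral_gt0 mB B0
  (bloom_weight_integrable hX hp hq hlambda1 hlambda2 x r0)
  (bloom_weight_gt0 hlambda1 hlambda2).
pose N := \int[mu]_(y in B) nu y; rewrite -[0 < _]/(0 < N) in N0.
have ibc : cintegrable mu B (fun y => b y - caverage mu B b).
  apply: cintegrableB => //.
    split; last exact: bloc.2.
    by apply: cmeasurable_onW => //; exact: bloc.1.
  by apply: (@cintegrable_bounded _ _ _ _ _ _ (cabs (caverage mu B b))) => //.
rewrite -[X in (_ * X)%E]fineK; last exact: integrable_fin_num (cintegrable_cabs ibc).
rewrite -!EFinM lee_fin mulrC -ler_pdivrMl// mulrC.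
(* Boundedness of the commutator makes the set of bounds nonempty, so its infimum is genuine and it
   suffices to treat each bound [Theta]. *)
apply: lb_le_inf; first by exists th0.
move=> Theta hTheta /=.
rewrite ler_pdivrMl// -/N.
have hosc := hC b Theta bloc hTheta x r r0; rewrite -/B -/nu -/N in hosc.
have NS0 : 0 < N `^ (p^-1 + (q - 1) / q) by exact: powR_gt0.
(* The two normalising powers of [nu(B)] combine, as [alpha / Q + 1 = 1/p - 1/q + 1 = 1/p +
   1/q']. *)
have -> : N `^ (- (alpha / doubling_order rho mu)) * N^-1 =
    (N `^ (p^-1 + (q - 1) / q))^-1.
  rewrite halpha -[N^-1]powR_inv1 ?(ltW N0)// -powRD; last first.
    by apply/implyP => _; rewrite gt_eqF.
  by rewrite -powRN; congr (_ `^ _); field; rewrite !gt_eqF.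
by rewrite ler_pdivrMl// mulrC.
Qed.
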